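(* Let $\mathcal X$ be a finite set. Let $\underline{\psi}$ be a permissive specification (with permissivity constant $\kappa$) for an $R$-tree like graph $G=(V,E)$ of maximal degree $\Delta\ge 2$, and let $\delta(\cdot)$ be a valid rate function (with associated constant $\delta_*>0$). If the canonical measure $\mu_{G,\underline{\psi}}$ is extremal for $G$ with rate $\delta(\cdot)$, then for all $r<R-1$ it is $(\varepsilon,r)$-Bethe approximated by its standard message set with $\varepsilon=\exp(c^r)\,\delta(R-r)$, where the (universal) constant $c$ depends only on $|\mathcal X|$, $\delta_*$, $\kappa$ and $\Delta$. In particular, $\mu_{G,\underline{\psi}}$ is then an $(\varepsilon,r)$-Bethe state for the graph-specification pair $(G,\underline\psi)$. (Here $\mathcal X$ denotes the finite variable domain.)
   Context: $G=(V,E)$ is a finite simple graph, $\mathcal X$ a finite set (variable domain), $\partial i$ the set of neighbors of $i$, $d(\cdot,\cdot)$ the graph distance in $G$; for $A,B\subseteq V$, $d(A,B)=\min\{d(i,j):i\in A,j\in B\}$. $\|\cdot\|_{TV}$ is total variation distance. For a measure $\rho$ on $\mathcal X^V$ and $U\subseteq V$, $\rho_U$ is the marginal law of $\underline x_U=\{x_i:i\in U\}$. A bounded specification $\underline\psi$ is a family of functions $\psi_{ij}:\mathcal X\times\mathcal X\to[0,\psi_{\max}]$, $(i,j)\in E$, with $\psi_{ij}(x,x')=\psi_{ji}(x',x)$, together with functions $\psi_i:\mathcal X\to[0,\psi_{\max}]$, $i\in V$, where $\psi_{\max}$ is a finite positive constant. It is permissive if there are $\kappa>0$ and, for each $i\in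 V$, a permitted state $x_i^{p}\in\mathcal X$ such that $\min_{i,x'}\psi_i(x')\ge\kappa\psi_{\max}$ and $\min_{(i,j)\in E,\,x'\in\mathcal X}\psi_{ij}(x_i^{p},x')=\min_{(i,j)\in E,\,x'\in\mathcal X}\psi_{ij}(x',x_j^{p})\ge\kappa\psi_{\max}$. The canonical measure is $\mu_{G,\underline\psi}(\underline x)=\frac1{Z(G,\underline\psi)}\prod_{(i,j)\in E}\psi_{ij}(x_i,x_j)\prod_{i\in V}\psi_i(x_i)$ on $\mathcal X^V$. A set of messages is a collection $\{\nu_{i\to j}\}$ of probability distributions on $\mathcal X$ indexed by the directed edges $i\to j$ with $(i,j)\in E$. The standard message set of $\mu_{G,\underline\psi}$ is $\nu^*_{i\to j}(x_i)=\mu^{(ij)}_i(x_i)$, the marginal on $i$ of $\mu^{(ij)}(\underline x)=\frac1{Z_{ij}}\prod_{(k,l)\in E\setminus(i,j)}\psi_{kl}(x_k,x_l)\prod_{k\in V}\psi_k(x_k)$. For $U\subseteq V$ let $\partial U=\{i\in U:\partial i\not\subseteq U\}$, $E_U=\{(i,j)\in E:i,j\in U\}$, $G_U=(U,E_U)$, $\mathrm{diam}(U)=\max\{d(i,j):i,j\in U\}$. Let $\mathcal U$ be the collection of $U\subseteq V$ such that $G_U$ is a tree and each $i\in\partial U$ is a leaf of $G_U$ (i.e. $|\partial i\cap U|=1$). A set of messages induces on each $U\in\mathcal U$ the probability measure $\nu_U(\underline x_U)=\frac1{Z_U}\prod_{i\in U}\psi_i^*(x_i)\prod_{(i,j)\in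 E_U}\psi_{ij}(x_i,x_j)$, where $\psi^*_i=\psi_i$ for $i\in U\setminus\partial U$, and $\psi_i^*=\nu_{i\to u(i)}$ with $\{u(i)\}=\partial i\cap U$ for $i\in\partial U$. A probability measure $\rho$ on $\mathcal X^V$ is $(\varepsilon,r)$-Bethe approximated by $\{\nu_{i\to j}\}$ if $\sup_{U\in\mathcal U,\ \mathrm{diam}(U)\le 2r}\|\rho_U-\nu_U\|_{TV}\le\varepsilon$; any such $\rho$ is called an $(\varepsilon,r)$-Bethe state for $(G,\underline\psi)$. A valid rate function is a non-increasing $\delta:\mathbb N\to[0,1]$ with $\delta(r)\to0$ as $r\to\infty$ and $\delta(r+1)\ge\delta_*\delta(r)$ for some $\delta_*>0$ and all $r\in\mathbb N$. $G$ is $R$-tree like ($R\ge0$ integer) if its girth exceeds $2R+1$. A probability measure $\rho$ on $\mathcal X^V$ is extremal for $G$ with valid rate function $\delta$ if for all $A,B\subseteq V$, $\|\rho_{A,B}(\cdot,\cdot)-\rho_A(\cdot)\rho_B(\cdot)\|_{TV}\le\delta(d(A,B))$, where $\rho_{A,B}$ is the joint law of $(\underline x_A,\underline x_B)$. *)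

(* Defs.v *)
From HB Require Import structures.
From mathcomp Require Import all_boot all_order all_algebra.
From mathcomp Require Import classical_sets reals topology normedtype sequences exp.
Import Order.TTheory GRing.Theory Num.Theory.
Import numFieldNormedType.Exports.

Set Implicit Arguments.
Unset Strict Implicit.
Unset Printing Implicit Defensive.

Local Open Scope ring_scope.

(* Extended naturals: None stands for +oo, the distance between vertices of
   different components and the girth of a forest. *)
Definition enat : Type := option nat.

Definition eleq (m n : enat) : bool :=
  match m, n with
  | _, None => true
  | Some a, Some b => (a <= b)%N
  | None, Some _ => false
  end.

Definition eltn (m n : enat) : bool := ~~ eleq n m.
Definition emin (m n : enat) : enat := if eleq m n then m else n.
Definition emax (m n : enat) : enat := if eleq m n then n else m.

Section Graph.
Variables (V : finType) (e : rel V).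

Definition simple_graph : Prop := symmetric e /\ irreflexive e.

Definition nbhd (i : V) : {set V} := [set j | e i j].

Definition max_degree : nat := \max_(i : V) #|nbhd i|.

Definition walk (n : nat) (i j : V) : bool :=
  [exists p : n.-tuple V, path e i p && (last i p == j)].

(* The search bounds in gdist and girth lose nothing: a shortest walk has fewer
   than #|V| steps, and a simple cycle at most #|V| vertices. *)
Definition gdist (i j : V) : enat :=
  ohead [seq n <- iota 0 #|V| | walk n i j].

Definition set_dist (A B : {set V}) : enat :=
  \big[emin/None]_(i in A) \big[emin/None]_(j in B) gdist i j.

Definition diam (U : {set V}) : enat :=
  \big[emax/Some 0%N]_(i in U) \big[emax/Some 0%N]_(j in U) gdist i j.

(* Length at least 3, since ucycleb accepts an edge walked back and forth. *)
Definition has_cycle (n : nat) : bool :=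
  (2 < n)%N && [exists c : n.-tuple V, ucycleb e c].

Definition girth : enat := ohead [seq n <- iota 0 #|V|.+1 | has_cycle n].

Definition tree_like (N : nat) : Prop := eltn (Some (2 * N + 1)%N) girth.

Definition is_tree : Prop :=
  (0 < #|V|)%N /\ (forall i j, connect e i j) /\ (forall n, ~~ has_cycle n).

Definition del_edge (i j : V) : rel V :=
  [rel k l | e k l && ([set k; l] != [set i; j])].

Definition boundary (U : {set V}) : {set V} :=
  [set i in U | ~~ (nbhd i \subset U)].

Definition induced (U : {set V}) : rel {i : V | i \in U} :=
  [rel i j | e (val i) (val j)].

End Graph.
Arguments induced {V} e U.

(* The collection written as a calligraphic U. *)
Definition bethe_region (V : finType) (e : rel V) (U : {set V}) : Prop :=
  is_tree (induced e U) /\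
  (forall i, i \in boundary e U -> #|nbhd e i :&: U| = 1%N).

Section Measures.
Variable R : realType.

Definition is_distr (T : finType) (p : T -> R) : Prop :=
  (forall x, 0 <= p x) /\ \sum_x p x = 1.

Definition tv (T : finType) (p q : T -> R) : R :=
  2^-1 * \sum_x `|p x - q x|.

Section Marginals.
Variables (V X : finType).

Definition restrict (U : {set V}) (x : {ffun V -> X}) :
    {ffun {i : V | i \in U} -> X} := [ffun i => x (val i)].

Definition marginal (rho : {ffun V -> X} -> R) (U : {set V})
    (y : {ffun {i : V | i \in U} -> X}) : R :=
  \sum_(x | restrict U x == y) rho x.

Definition joint_marginal (rho : {ffun V -> X} -> R) (A B : {set V})
    (y : {ffun {i : V | i \in A} -> X} * {ffun {i : V | i \in B} -> X}) : R :=
  \sum_(x | (restrict A x == y.1) && (restrict B x == y.2)) rho x.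

End Marginals.
Arguments marginal {V X} rho U.
Arguments joint_marginal {V X} rho A B.

Section Gibbs.
Variables (V X : finType) (e : rel V).
Variables (psie : V -> V -> X -> X -> R) (psiv : V -> X -> R).

(* The order given by enum_rank selects one orientation of each undirected
   edge; by the symmetry psie i j x y = psie j i y x the choice is immaterial. *)
Definition gibbs_weight (x : {ffun V -> X}) : R :=
  (\prod_(p : V * V | e p.1 p.2 && (enum_rank p.1 < enum_rank p.2)%N)
     psie p.1 p.2 (x p.1) (x p.2))
  * \prod_(i : V) psiv i (x i).

Definition partition_fun : R := \sum_x gibbs_weight x.

Definition gibbs (x : {ffun V -> X}) : R := gibbs_weight x / partition_fun.

End Gibbs.

Section Specifications.
Variables (V X : finType) (e : rel V).
Variables (psie : V -> V -> X -> X -> R) (psiv : V -> X -> R).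

(* Values of psie i j at non-adjacent i, j are never used. *)
Definition bounded_spec (psimax : R) : Prop :=
  [/\ 0 < psimax,
      forall i j, e i j -> forall x y, 0 <= psie i j x y <= psimax,
      forall i j, e i j -> forall x y, psie i j x y = psie j i y x
    & forall i x, 0 <= psiv i x <= psimax].

Definition permissive (psimax kappa : R) : Prop :=
  [/\ 0 < kappa,
      forall i x, kappa * psimax <= psiv i x
    & exists xp : V -> X, forall i j, e i j -> forall x,
        kappa * psimax <= psie i j (xp i) x /\
        kappa * psimax <= psie i j x (xp j)].

(* A family of messages nu, with nu i j the message i -> j; only the values at
   adjacent i, j matter. *)
Definition message_set (nu : V -> V -> X -> R) : Prop :=
  forall i j, e i j -> is_distr (nu i j).

Definition standard_messages (i j : V) (a : X) : R :=
  \sum_(x : {ffun V -> X} | x i == a) gibbs (del_edge e i j) psie psiv x.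

(* For i on the boundary of a region U the set nbhd e i :&: U is a singleton
   {u(i)}, which pick returns; the None branch is never reached there. *)
Definition psi_star (nu : V -> V -> X -> R) (U : {set V}) (i : V) (a : X) : R :=
  if i \in boundary e U then
    if [pick u in nbhd e i :&: U] is Some u then nu i u a else psiv i a
  else psiv i a.

Definition bethe_measure (nu : V -> V -> X -> R) (U : {set V}) :
    {ffun {i : V | i \in U} -> X} -> R :=
  gibbs (induced e U) (fun i j => psie (val i) (val j))
    (fun i => psi_star nu U (val i)).
Arguments bethe_measure : clear implicits.

Definition bethe_approximated (eps : R) (r : nat)
    (rho : {ffun V -> X} -> R) (nu : V -> V -> X -> R) : Prop :=
  [/\ is_distr rho, message_set nu
    & forall U : {set V}, bethe_region e U -> eleq (diam e U) (Some (2 * r)%N) ->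
        tv (marginal rho U) (bethe_measure nu U) <= eps].

Definition bethe_state (eps : R) (r : nat) (rho : {ffun V -> X} -> R) : Prop :=
  exists nu : V -> V -> X -> R, bethe_approximated eps r rho nu.

End Specifications.

Definition valid_rate (dstar : R) (delta : nat -> R) : Prop :=
  [/\ forall n, 0 <= delta n <= 1,
      nonincreasing_seq delta,
      (delta n @[n --> \oo] --> (0 : R))%classic,
      0 < dstar
    & forall n, dstar * delta n <= delta n.+1].

(* The rate at infinite distance is the limit of delta, namely 0. *)
Definition rate_at (delta : nat -> R) (n : enat) : R :=
  if n is Some m then delta m else 0.

Definition extremal (V X : finType) (e : rel V) (delta : nat -> R)
    (rho : {ffun V -> X} -> R) : Prop :=
  forall A B : {set V},
    tv (joint_marginal rho A B)
       (fun y => marginal rho A y.1 * marginal rho B y.2)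
    <= rate_at delta (set_dist e A B).

End Measures.
Arguments marginal {R V X} rho U.
Arguments joint_marginal {R V X} rho A B.
Arguments bethe_measure {R V X} e psie psiv nu U.

(* Main.v *)
Require Import Defs.
From HB Require Import structures.
From mathcomp Require Import all_boot all_order all_algebra ring zify.
From mathcomp Require Import classical_sets reals topology normedtype sequences exp.
Import Order.TTheory GRing.Theory Num.Theory.
Import numFieldNormedType.Exports.
Local Open Scope ring_scope.

Set Implicit Arguments.
Unset Strict Implicit.
Unset Printing Implicit Defensive.

(** Let U be a region of diameter at most [2 * r] and suppose first that
    [2 * r <= N].  Delete the edges inside U.  By the girth bound, short walks
    starting from different vertices of U never meet ([outer_walk_inj]), so the
    set of vertices within [N - r] steps of U splits into disjoint branches,
    one per vertex of U, which touch each other only through the set B of the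
    remaining vertices ([branch_closed]).  Given the configuration on B, the
    branches are therefore independent, and the conditional law on U is exactly
    a Bethe measure: the weight of the tree U times one message per boundary
    vertex ([exterior_weight_factor], [conditional_product]).

    Extremality bounds the average effect on the law of U of conditioning on B,
    because B is farther than [N - r] from U ([far_dist]).  Permissivity makes
    each conditional message readable from the law on U: fix the permitted
    state on all of U except one boundary vertex, and divide by the weight of
    the tree, which is bounded below there.  Hence the conditional messages are
    nearly constant in the configuration on B ([conditional_message_dist]).  A
    standard message is the average of the conditional messages under the
    measure with one edge removed, whose law on B has bounded density with
    respect to that of the Gibbs measure ([cavity_le]); so it is close to them
    as well ([averaged_message_dist]), and replacing all of them in the
    conditional law on U gives [bethe_estimate].

    Every loss in this argument is at most exponential in [#|U| ^ 2], which is
    at most [(1 + Delta) ^ (4 * r)] ([card_region]), and [expR (c ^+ r)] absorbs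
    it ([power_le_exp]).  It also absorbs the case [N < 2 * r], where the region
    need not be isometrically embedded: if there are at least two states, then
    extremality at distance 0 bounds [delta 0] below by a constant
    ([extremal_rate0]), so [delta (N - r)] is at least geometric in [r] while
    the total variation distance is at most 1; with a single state both measures
    coincide.  When [r = 0] the region is an isolated vertex, there are no
    messages, and the bound holds without any constant. *)

(** * Short paths in graphs of large girth *)
Section ShortPaths.
Local Open Scope nat_scope.
Variables (V : finType) (e : rel V).
Hypothesis e_sym : symmetric e.

(** Two different simple paths with the same ends contain a cycle: after their
    common beginning, follow the first path until it meets the second one
    again, and come back along the second one. *)
Lemma short_paths_eq (L : nat) (x : V) (p q : seq V) :
    (forall n, n <= L -> ~~ has_cycle e n) ->
    path e x p -> path e x q -> uniq (x :: p) -> uniq (x :: q) ->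
    last x p = last x q -> size p + size q <= L -> p = q.
Proof.
move=> acyc; elim: p x q => [|a p IH] x [|b q] //=.
- by move=> _ _ _ /andP[xq _] xE _; case/negP: xq; rewrite xE; exact: mem_last.
- by move=> _ _ /andP[xp _] _ xE _; case/negP: xp; rewrite -xE; exact: mem_last.
move=> /andP[xa ap] /andP[xb bq] /andP[xp up] /andP[xq uq] lE szL.
case: (altP (a =P b)) => [ab|ab].
  subst b; congr (_ :: _); apply: (IH a) => //.
  by apply: leq_trans szL; rewrite addSn addnS; exact: leqW (leqnSn _).
have hasq : has [in b :: q] (a :: p).
  by apply/hasP; exists (last a p); rewrite ?mem_last // lE mem_last.
have path_p : path e x (a :: p) by rewrite /= xa.
have path_q : path e x (b :: q) by rewrite /= xb.
have {}xp : x \notin a :: p by [].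
have {}xq : x \notin b :: q by [].
have szp : size (a :: p) + size (b :: q) <= L by [].
have {}up : uniq (a :: p) by [].
have {}uq : uniq (b :: q) by [].
(* Both paths are generalised below so as to be cut where they meet again;
   this keeps the fact that their first steps differ. *)
have abE : forall s t, a :: p = s -> b :: q = t -> head x s <> head x t.
  by move=> s t <- <- /= /eqP; rewrite (negPf ab).
move: (a :: p) (b :: q) abE hasq path_p path_q xp xq szp up uq
  => {a p b q xa xb ap bq lE szL IH ab} p q abE hasq.
move: (erefl p) (erefl q) => pE0 qE0; have {pE0 qE0}abE := abE _ _ pE0 qE0.
case: (split_find hasq) abE => z p1 p2 zq p1q.
rewrite cat_rcons => abE.
case/splitPr: zq abE p1q => q1 q2 abE p1q.
rewrite -cat_rcons cat_path rcons_path => /andP[/andP[pp1 lz] _].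
rewrite -cat_rcons cat_path => /andP[pq1 _].
rewrite !mem_cat !mem_rcons !negb_or => /andP[/andP[xz xp1] _] /andP[/andP[_ xq1] _].
rewrite !size_cat !size_rcons => szL.
rewrite !cat_uniq !rcons_uniq => /andP[/andP[zp1 up1] _] /andP[/andP[zq1 uq1] _].
have dis : ~~ has [in p1] (z :: q1).
  apply/hasPn => y; rewrite inE => /predU1P[-> //|yq1]; apply/negP => yp1.
  by case/hasP: p1q; exists y; rewrite //= mem_cat yq1.
pose c := x :: p1 ++ z :: rev q1.
have cyc : cycle e c.
  rewrite /c [cycle _ _]/= rcons_cat rcons_cons cat_path /= pp1 lz /=.
  have := rev_path e x (rcons q1 z).
  rewrite last_rcons belast_rcons rev_cons => ->.
  rewrite (eq_path (e' := e)) // => u v /=; exact: e_sym.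
have uc : uniq c.
  rewrite /c /= mem_cat inE mem_rev !negb_or xp1 xz xq1 /=.
  rewrite cat_uniq up1 /= mem_rev zq1 rev_uniq uq1 !andbT /=.
  move: dis; rewrite /= !negb_or => /andP[zp1' hq1].
  by rewrite zp1' has_rev.
have sc : size c = (size p1 + size q1).+2 by rewrite /= size_cat /= size_rev addnS.
have sc2 : 2 < size c.
  rewrite sc; case: p1 abE {pp1 lz xp1 szL zp1 up1 dis p1q c cyc uc sc} => [|a p1] //.
  by case: q1 {pq1 xq1 zq1 uq1} => [|b q1].
have cL : size c <= L.
  rewrite sc; apply: leq_trans szL.
  by rewrite addnACA !addSn addnS !ltnS; exact: leq_addr.
case/negP: (acyc _ cL); rewrite /has_cycle sc2 /=.
by apply/existsP; exists (in_tuple c); rewrite /= /ucycleb cyc uc.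
Qed.

Lemma gdist_walk (i j : V) (m : nat) : gdist e i j = Some m -> walk e m i j.
Proof.
rewrite /gdist => h.
have : m \in [seq n <- iota 0 #|V| | walk e n i j].
  by case: [seq _ <- _ | _] h => [|a l] //= [->]; rewrite inE eqxx.
by rewrite mem_filter => /andP[].
Qed.

Lemma walkP (e0 : rel V) (n : nat) (i j : V) :
  reflect (exists p, [/\ path e0 i p, last i p = j & size p = n]) (walk e0 n i j).
Proof.
apply: (iffP existsP) => [[p /andP[pp /eqP lp]]|[p [pp lp /eqP sp]]].
  by exists p; rewrite size_tuple.
by exists (Tuple sp); rewrite /= pp lp eqxx.
Qed.

Lemma tree_like_acyclic (N n : nat) :
  tree_like e N -> n <= 2 * N + 1 -> ~~ has_cycle e n.
Proof.
rewrite /tree_like /eltn /girth => gN nN; apply/negP => cn.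
have nV : n <= #|V|.
  move: cn => /andP[_ /existsP[c /andP[_ uc]]].
  by rewrite -(size_tuple c) -(card_uniqP uc); exact: max_card.
move: gN; have : n \in [seq m <- iota 0 #|V|.+1 | has_cycle e m].
  by rewrite mem_filter cn mem_iota.
have : sorted leq [seq m <- iota 0 #|V|.+1 | has_cycle e m].
  by apply: sorted_filter; [exact: leq_trans | exact: iota_sorted].
case: [seq _ <- _ | _] => [|a l] //=; rewrite inE => /order_path_min al.
case/predU1P => [na|nl] /negP; case; first by rewrite -na.
by apply: leq_trans nN; have /allP/(_ n nl) := al leq_trans.
Qed.

Lemma diam_gdist (U : {set V}) (m : nat) (i j : V) :
    eleq (diam e U) (Some m) -> i \in U -> j \in U ->
  exists2 k, k <= m & walk e k i j.
Proof.
have maxP (A : {set V}) (F : V -> enat) k :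
    eleq (\big[emax/Some 0]_(v in A) F v) (Some k) ->
    forall v, v \in A -> eleq (F v) (Some k).
  move=> h v vA; have := mem_index_enum v; elim: (index_enum V) h => // a s IH.
  have maxE x y : eleq (emax x y) (Some k) = eleq x (Some k) && eleq y (Some k).
    case: x y => [x|] [y|] //=; rewrite /emax /= ?andbF //.
    by case: leqP => xy /=; [case: (leqP y k) | case: (leqP x k)] => yk;
       rewrite ?andbT ?andbF //; apply/esym;
       [exact: leq_trans yk | apply: leq_trans yk; exact: ltnW].
  rewrite big_cons inE; case: ifP => [_|aA].
    by rewrite maxE => /andP[Fa Fs] /predU1P[->|/IH]; [|exact].
  by move=> Fs /predU1P[va|/IH]; [rewrite -va vA in aA|exact].
move=> /maxP h iU jU; have /maxP/(_ j jU) := h i iU.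
case E: (gdist e i j) => [k|] //= km; exists k => //; exact: gdist_walk.
Qed.

Lemma set_dist_gt (A B : {set V}) (D : nat) :
    (forall i j m, i \in A -> j \in B -> walk e m i j -> D < m) ->
  if set_dist e A B is Some m then D < m else true.
Proof.
move=> h; pose K (n : enat) := if n is Some m then D < m else true.
have Kmin a b : K a -> K b -> K (emin a b) by rewrite /emin; case: ifP.
rewrite -/(K _) /set_dist.
apply: (big_ind K) => // i iA.
apply: (big_ind K) => // j jB; rewrite /K.
case E: (gdist e i j) => [m|] //; exact: (h i j m iA jB (gdist_walk E)).
Qed.

End ShortPaths.

(** * The branches attached to a region *)
Section Region.
Local Open Scope nat_scope.
Variables (V : finType) (e : rel V).
Hypothesis e_sym : symmetric e.
Variables (U : {set V}) (N r : nat).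
Hypotheses (treeN : tree_like e N) (treeU : bethe_region e U).
Hypotheses (diamU : eleq (diam e U) (Some (2 * r))) (rN : 2 * r <= N).

Definition outer : rel V := [rel k l | e k l && ~~ ((k \in U) && (l \in U))].

(** The length bound [N - r] is the largest for which two branches joined by an
    edge, closed up by a path of length [2 * r] in the region, would give a
    cycle of length at most [2 * N + 1]. *)
Definition branch (i : V) : {set V} :=
  [set v | [exists n : 'I_(N - r).+1, walk outer n i v]].

Definition far_set : {set V} := [set v | [forall i in U, v \notin branch i]].

Lemma outer_sym : symmetric outer.
Proof. by move=> k l; rewrite /outer /= e_sym [(k \in U) && _]andbC. Qed.

Lemma branchP (i v : V) :
  reflect (exists p, [/\ path outer i p, last i p = v & size p <= N - r])
          (v \in branch i).
Proof.
rewrite inE; apply: (iffP existsP) => [[n /walkP[p [pp lp sp]]]|[p [pp lp sp]]].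
  by exists p; split => //; rewrite sp -ltnS.
rewrite -ltnS in sp; exists (Ordinal sp); apply/walkP; by exists p.
Qed.

Lemma far_setP (v : V) :
  reflect (forall i, i \in U -> v \notin branch i) (v \in far_set).
Proof. by rewrite finset.in_set; exact: forall_inP. Qed.

Lemma branch_self (i : V) : i \in branch i.
Proof. by apply/branchP; exists [::]. Qed.

(** A path of the region of length exactly [2 * r + 1] would share its ends with
    a shorter path of the graph, by the bound on the diameter; the two together
    are too short to contain a cycle. *)
Lemma inner_path (i j : V) : i \in U -> j \in U ->
  exists p, [/\ path e i p, last i p = j, uniq (i :: p), all [in U] p
             & size p <= 2 * r].
Proof.
move=> iU jU; have [[_ [conn _]] _] := treeU.
have /connectP[s sp] := conn (Sub i iU) (Sub j jU).
case/shortenP: sp => {}s sp us _ /(congr1 val) /= lj.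
pose p := map val s.
have pp : path e i p.
  have map_ind b t : path (induced e U) b t -> path e (val b) (map val t).
    by elim: t b => //= a t IH b /andP[ba /IH ->]; rewrite andbT.
  exact: map_ind sp.
have lp : last i p = j by rewrite lj /p (last_map val s (exist _ i iU)).
have up : uniq (i :: p).
  by rewrite (_ : i :: p = map val (exist _ i iU :: s)) // map_inj_uniq //;
     exact: val_inj.
have ap : all [in U] p by apply/allP => v /mapP[w _ ->]; exact: valP.
exists p; split => //; rewrite leqNgt; apply/negP => sz.
pose q := take (2 * r).+1 p.
have sq : size q = (2 * r).+1 by rewrite size_takel.
have pq : path e i q.
  by move: pp; rewrite -{1}(cat_take_drop (2 * r).+1 p) cat_path => /andP[].
have uq : uniq (i :: q).
  by move: up; rewrite -{1}(cat_take_drop (2 * r).+1 p) -cat_cons cat_uniq => /andP[].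
have vU : last i q \in U.
  have : all [in U] (i :: q).
    by rewrite /= iU /=; apply/allP => v /mem_take; exact: (allP ap).
  by move/allP; apply; exact: mem_last.
have [k km /walkP[t [pt lt st]]] := diam_gdist diamU iU vU.
case/shortenP: pt lt => t' pt' ut' sub lt'.
have st' : size t' <= 2 * r.
  apply: leq_trans km; rewrite -st; apply: uniq_leq_size => //.
  by case/andP: ut'.
have tq : t' = q.
  apply: (short_paths_eq e_sym (L := 2 * N + 1) (x := i)) => //.
    by move=> n; exact: tree_like_acyclic.
  rewrite sq addnS addn1 ltnS [2 * N]mul2n -addnn; apply: leq_add => //.
  exact: leq_trans st' rN.
by move: st'; rewrite tq sq ltnn.
Qed.

(** The walk, made simple, and the path inside the region have the same ends
    and are together shorter than the girth, so they are equal; but the first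
    step of one leaves the region and that of the other does not. *)
Lemma outer_walk_inj (i j : V) (p : seq V) : i \in U -> j \in U ->
  path outer i p -> last i p = j -> size p <= 2 * (N - r) + 1 -> i = j.
Proof.
move=> iU jU pp lp sp; apply/eqP/negPn/negP => ij.
case/shortenP: pp lp => p' pp' up' sub lp'.
have sp' : size p' <= 2 * (N - r) + 1.
  by apply: leq_trans sp; apply: uniq_leq_size => //; case/andP: up'.
have [q [pq lq uq aq sq]] := inner_path iU jU.
have pe : path e i p' by apply: sub_path pp' => a b /andP[].
have pqE : p' = q.
  apply: (short_paths_eq e_sym (L := 2 * N + 1) (x := i)) => //.
  - by move=> n; exact: tree_like_acyclic.
  - by rewrite lp' lq.
  - apply: leq_trans (leq_add sp' sq) _.
    rewrite addnAC leq_add2r -mulnDr subnK //.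
    by apply: leq_trans rN; exact: leq_pmull.
case: p' pqE pp' lp' {up' sub sp' pe} => [|a p'] pqE /=.
  by move=> _ ijE; rewrite ijE eqxx in ij.
move=> /andP[/andP[_ /negP h] _] _; case: h; rewrite iU /=.
by move: aq; rewrite -pqE => /andP[].
Qed.

Lemma branch_disj (i j v : V) : i \in U -> j \in U ->
  v \in branch i -> v \in branch j -> i = j.
Proof.
move=> iU jU /branchP[p [pp lp sp]] /branchP[q [pq lq sq]].
have pq' : path outer v (rev (belast j q)).
  by rewrite -lq rev_path (eq_path (e' := outer)) // => a b /=; rewrite outer_sym.
apply: (outer_walk_inj (p := p ++ rev (belast j q)) iU jU).
- by rewrite cat_path pp lp.
- rewrite last_cat lp; case: q {pq sq pq'} lq => [|a q] //= lq.
  by rewrite rev_cons last_rcons.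
- rewrite size_cat size_rev size_belast; apply: leq_trans (leq_add sp sq) _.
  by rewrite addnn -mul2n leq_addr.
Qed.

Lemma branch_region (i j : V) : i \in U -> j \in U -> j \in branch i -> i = j.
Proof. by move=> iU jU ji; apply: (branch_disj iU jU ji); exact: branch_self. Qed.

Lemma branch_closed (i k l : V) : i \in U -> outer k l ->
  k \in branch i -> (l \in branch i) || (l \in far_set).
Proof.
move=> iU kl ki; rewrite orbC -implyNb; apply/implyP.
rewrite finset.in_set negb_forall => /existsP[j].
rewrite negb_imply negbK => /andP[jU lj]; suff -> : i = j by [].
move: ki lj => /branchP[p [pp lp sp]] /branchP[q [pq lq sq]].
have pq' : path outer l (rev (belast j q)).
  by rewrite -lq rev_path (eq_path (e' := outer)) // => a b /=; rewrite outer_sym.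
apply: (outer_walk_inj (p := p ++ l :: rev (belast j q)) iU jU).
- by rewrite cat_path pp lp /= kl.
- rewrite last_cat lp /=; case: q {pq sq pq'} lq => [|a q] //= lq.
  by rewrite rev_cons last_rcons.
- rewrite size_cat /= size_rev size_belast addnS addn1 ltnS mul2n -addnn.
  exact: leq_add.
Qed.

Lemma branch_outer_edge (i k l : V) : i \in U -> outer k l ->
  (k \in branch i) && ((l \in branch i) || (l \in far_set)) ||
  (l \in branch i) && ((k \in branch i) || (k \in far_set)) ||
  (k \notin branch i) && (l \notin branch i).
Proof.
move=> iU kl; case: (boolP (k \in branch i)) => ki /=.
  by rewrite (branch_closed iU kl ki).
case: (boolP (l \in branch i)) => li //=; rewrite orbF.
have := branch_closed (k := l) (l := k) iU.
by rewrite outer_sym (negPf ki) => /(_ kl li) /= ->.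
Qed.

Lemma far_branch (i v : V) : i \in U -> v \in far_set -> v \notin branch i.
Proof. by move=> iU /far_setP; exact. Qed.

Lemma region_far (i : V) : i \in U -> i \notin far_set.
Proof. by move=> iU; apply: contraL (branch_self i); exact: far_branch. Qed.

(** Cut the walk after its last visit to the region. *)
Lemma last_exit (i : V) (p : seq V) : i \in U -> path e i p ->
  exists2 j, j \in U &
    exists q, [/\ path outer j q, last j q = last i p & size q <= size p].
Proof.
move=> iU; elim/last_ind: p => [_|p a IH]; first by exists i => //; exists [::].
rewrite rcons_path last_rcons => /andP[/IH[j jU [q [pq lq sq]]] la].
case: (boolP (a \in U)) => [aU|aU]; first by exists a => //; exists [::].
exists j => //; exists (rcons q a).
by rewrite rcons_path pq lq /outer /= la (negPf aU) andbF last_rcons !size_rcons.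
Qed.

Lemma far_dist :
  if set_dist e U far_set is Some m then N - r < m else true.
Proof.
apply: set_dist_gt => i j m iU jB /walkP[p [pp lp sp]].
rewrite ltnNge; apply/negP => mN.
have [k kU [q [pq lq sq]]] := last_exit iU pp.
case/negP: (far_branch kU jB); apply/branchP; exists q; split=> //.
  by rewrite lq.
by apply: leq_trans mN; rewrite -sp.
Qed.

End Region.

(** * The size of a region *)
Section RegionSize.
Local Open Scope nat_scope.
Variables (V : finType) (e : rel V).

Lemma card_walk_ball (d : nat) (i : V) :
  #|[set v | [exists n : 'I_d.+1, walk e n i v]]| <= (1 + max_degree e) ^ d.
Proof.
elim: d => [|d IH].
  rewrite expn0; apply: (@leq_trans #|[set i]|); last by rewrite cards1.
  apply/subset_leq_card/fintype.subsetP => v.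
  rewrite !inE => /existsP[n /walkP[p [_ <- sp]]].
  by case: p sp => [|a p]; rewrite ?eqxx // (ord1 n).
pose S := [set v | [exists n : 'I_d.+1, walk e n i v]].
have sub : [set v | [exists n : 'I_d.+2, walk e n i v]] \subset
    S :|: \bigcup_(u in S) nbhd e u.
  apply/fintype.subsetP => v; rewrite !inE => /existsP[n /walkP[p [pp lp sp]]].
  case/lastP: p pp lp sp => [|p a] pp lp sp.
    by apply/orP; left; apply/existsP; exists ord0; apply/walkP; exists [::].
  move: pp lp; rewrite rcons_path last_rcons => /andP[pp la] av; subst a.
  apply/orP; right; apply/bigcupP; exists (last i p); last by rewrite inE.
  have pd : size p < d.+1 by rewrite -ltnS -(size_rcons p v) sp ltn_ord.
  by rewrite inE; apply/existsP; exists (Ordinal pd); apply/walkP; exists p.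
apply: leq_trans (subset_leq_card sub) _.
apply: leq_trans (leq_card_setU _ _) _.
rewrite expnSr mulnDr muln1; apply: leq_add => //.
have : #|\bigcup_(u in S) nbhd e u| <= \sum_(u in S) #|nbhd e u|.
  apply: (big_ind2 (fun (A : {set V}) m => #|A| <= m)) => //; first by rewrite cards0.
  move=> A a B b Aa Bb; apply: leq_trans (leq_card_setU _ _) _; exact: leq_add.
move/leq_trans; apply; apply: (@leq_trans (\sum_(u in S) max_degree e)).
  by apply: leq_sum => u _; exact: (leq_bigmax (F := fun u => #|nbhd e u|)).
by rewrite sum_nat_const leq_mul2r IH orbT.
Qed.

Lemma card_region (U : {set V}) (d : nat) :
  eleq (diam e U) (Some d) -> #|U| <= (1 + max_degree e) ^ d.
Proof.
move=> dU; have [->|[i iU]] := set_0Vmem U; first by rewrite cards0.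
apply: leq_trans (card_walk_ball d i); apply/subset_leq_card/fintype.subsetP => v vU.
have [k kd kw] := diam_gdist dU iU vU; rewrite inE.
by rewrite -ltnS in kd; apply/existsP; exists (Ordinal kd).
Qed.

End RegionSize.

(** * Perturbation of normalised and of product weights *)
Section Perturbation.
Variable R : realType.

(** Only one of the two totals has to be positive: if the other one vanishes,
    the quotient is zero and the bound is trivial. *)
Lemma normalize_dist (T : finType) (f g : T -> R) :
    (forall x, 0 <= f x) -> (forall x, 0 <= g x) -> 0 < \sum_x f x ->
  \sum_x `|f x / (\sum_x f x) - g x / (\sum_x g x)|
    <= 2 * (\sum_x `|f x - g x|) / (\sum_x f x).
Proof.
move=> f0 g0; set F := \sum_x f x; set G := \sum_x g x => Fpos.
have G0 : 0 <= G by apply: sumr_ge0.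
have termE x : `|f x / F - g x / G| <= `|f x - g x| / F + g x * `|F^-1 - G^-1|.
  rewrite (_ : f x / F - g x / G = (f x - g x) / F + g x * (F^-1 - G^-1)); last first.
    by rewrite mulrBl mulrBr addrA subrK.
  by apply: le_trans (ler_normD _ _) _; rewrite !normrM (ger0_norm (g0 x))
    [`|F^-1|]ger0_norm // invr_ge0 ltW.
apply: (le_trans (ler_sum _ (fun x _ => termE x))).
rewrite big_split /= -!mulr_suml -/G mulr2n -mulrA mulrDl mul1r lerD2l.
have [->|Gn0] := eqVneq G 0.
  by rewrite mul0r mulr_ge0 ?invr_ge0 ?(ltW Fpos) // sumr_ge0.
have Gpos : 0 < G by rewrite lt_def Gn0.
rewrite (_ : F^-1 - G^-1 = (G - F) / (F * G)); last first.
  by field; rewrite Gn0 gt_eqF.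
rewrite normrM [`|(F * G)^-1|]gtr0_norm ?invr_gt0 ?mulr_gt0 //.
rewrite (_ : G * _ = `|G - F| / F); last by field; rewrite Gn0 gt_eqF.
rewrite ler_pM2r ?invr_gt0 // distrC -sumrB; exact: ler_norm_sum.
Qed.

Lemma prod_dist (I : Type) (s : seq I) (P : pred I) (a b : I -> R) :
    (forall i, P i -> 0 <= a i <= 1) -> (forall i, P i -> 0 <= b i <= 1) ->
  `|\prod_(i <- s | P i) a i - \prod_(i <- s | P i) b i|
    <= \sum_(i <- s | P i) `|a i - b i|.
Proof.
move=> a01 b01; elim: s => [|i s IH]; first by rewrite !big_nil subrr normr0.
rewrite !big_cons; case: ifP => // Pi.
set A := \prod_(j <- s | P j) a j; set B := \prod_(j <- s | P j) b j.
have A01 : 0 <= A <= 1 by apply/andP; split;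
  [apply: prodr_ge0 => j /a01 /andP[] | apply: prodr_ile1 => j /a01].
rewrite (_ : a i * A - b i * B = (a i - b i) * A + b i * (A - B)); last by ring.
apply: (le_trans (ler_normD _ _)); apply: lerD; rewrite normrM.
  by apply: ler_piMr => //; case/andP: A01 => A0 A1; rewrite ger0_norm.
case/andP: (b01 i Pi) => b0 b1; rewrite (ger0_norm b0).
by apply: le_trans IH; apply: ler_piMl.
Qed.

End Perturbation.

Section LocalUpdate.
Variables (I X : finType).

Definition update (y : {ffun I -> X}) (i : I) (a : X) : {ffun I -> X} :=
  [ffun j => if j == i then a else y j].

Lemma update_id y i : update y i (y i) = y.
Proof. by apply/ffunP => j; rewrite ffunE; case: eqP => // ->. Qed.

Lemma update_at y i a : update y i a i = a.
Proof. by rewrite ffunE eqxx. Qed.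

Lemma update_update y i a a' : update (update y i a) i a' = update y i a'.
Proof. by apply/ffunP => j; rewrite !ffunE; case: eqP. Qed.

End LocalUpdate.

(** * Bethe approximation from conditional independence *)

(** The estimate behind the theorem, without any graph.  A pair of a
    configuration [y] on a region and an exterior configuration [b] has
    probability [J y b = Phi y * G b y]; [G_swap] says that, for each [b], the
    coordinates of [y] are independent under the weight [G b].  For a boundary
    coordinate [i], [H i b a] is the joint law of coordinate [i] and of the
    exterior under the measure without the edge that joins [i] to the region,
    and [t] is a reference configuration of probability bounded below. *)
Section ConditionalIndependence.
Variables (R : realType) (I X T : finType) (bd : pred I).
Variables (Phi : {ffun I -> X} -> R) (G : T -> {ffun I -> X} -> R).
Variables (H : I -> T -> X -> R) (t : {ffun I -> X}).
Variables (M lam beta beta' K d : R).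

Let J y b := Phi y * G b y.
Let PU y := \sum_b J y b.
Let PB b := \sum_y J y b.
Let h i b := \sum_a H i b a.
Let Er b := \sum_y `|J y b - PU y * PB b|.
Let n i a := \sum_b H i b a.

Hypotheses (M_gt0 : 0 < M) (lam_gt0 : 0 < lam) (beta_gt0 : 0 < beta)
  (beta'_gt0 : 0 < beta') (K_ge0 : 0 <= K).
Hypotheses (Phi_ge0 : forall y, 0 <= Phi y) (Phi_le : forall y, Phi y <= M)
  (Phi_t : lam * M <= Phi t) (Phi_upd : forall i a, lam * M <= Phi (update t i a)).
Hypotheses (G_ge0 : forall b y, 0 <= G b y)
  (G_swap : forall b y z i,
     G b y * G b z = G b (update y i (z i)) * G b (update z i (y i)))
  (G_const : forall b y i a, ~~ bd i -> G b (update y i a) = G b y).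
Hypotheses (J_sum : \sum_b PB b = 1) (J_t : forall b, beta' * PB b <= J t b).
Hypotheses (H_ge0 : forall i b a, bd i -> 0 <= H i b a)
  (H_sum : forall i, bd i -> \sum_b h i b = 1)
  (H_swap : forall i b a z, bd i ->
     H i b a * G b z = H i b (z i) * G b (update z i a))
  (H_t : forall i b, bd i -> beta * h i b <= H i b (t i))
  (H_le : forall i b, bd i -> h i b <= K * PB b)
  (H_gt0 : forall i b, bd i -> 0 < PB b -> 0 < h i b).
Hypothesis decorrelated : \sum_b Er b <= d.

Let q : R := #|X|%:R.

Lemma joint_ge0 y b : 0 <= J y b.
Proof. by rewrite mulr_ge0. Qed.

Lemma exterior_ge0 b : 0 <= PB b.
Proof. by apply: sumr_ge0 => y _; exact: joint_ge0. Qed.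

Lemma correlation_ge0 b : 0 <= Er b.
Proof. by apply: sumr_ge0. Qed.

(** The exterior configurations at which conditioning moves the law on the
    region by at most the average bound have positive total probability. *)
Lemma good_exterior : exists2 b, 0 < PB b & Er b <= d * PB b.
Proof.
have [b /andP[] *|none] := pickP (fun b => (0 < PB b) && (Er b <= d * PB b)).
  by exists b.
have Er_gt b : 0 < PB b -> d * PB b < Er b.
  by move=> bpos; rewrite ltNge; move: (none b); rewrite bpos /= => ->.
have Er_all b : d * PB b <= Er b.
  have [/Er_gt/ltW //|] := ltP 0 (PB b).
  rewrite le_eqVlt ltNge exterior_ge0 orbF => /eqP ->; rewrite mulr0; exact: correlation_ge0.
have [b bpos] : exists b, 0 < PB b.
  apply/existsP; apply: contraT; rewrite negb_exists => /forallP PB0.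
  have := J_sum; rewrite big1 => [/eqP|b _]; first by rewrite eq_sym oner_eq0.
  by apply/eqP; rewrite eq_le exterior_ge0 leNgt PB0.
suff : \sum_b d * PB b < \sum_b Er b.
  by rewrite -mulr_sumr J_sum mulr1 ltNge decorrelated.
rewrite (bigD1 b) //= [ltRHS](bigD1 b) //=; apply: ltr_leD; first exact: Er_gt.
by apply: ler_sum => c _; exact: Er_all.
Qed.

Lemma reference_weight_gt0 b : 0 < PB b -> 0 < G b t.
Proof.
move=> bpos; have : 0 < J t b by apply: lt_le_trans (J_t b); exact: mulr_gt0.
rewrite lt_def mulf_eq0 negb_or => /andP[/andP[_ G0] _].
by rewrite lt_def G0 G_ge0.
Qed.

(** Change the coordinates of [t] into those of [y] one at a time; the exchange
    relation with [t] itself makes each change cost a factor that depends on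
    that coordinate only. *)
Lemma exterior_weight_factor b y : 0 < PB b ->
  G b y = G b t * \prod_(i | bd i) (G b (update t i (y i)) / G b t).
Proof.
move=> bpos; have Gt := reference_weight_gt0 bpos; have Gt0 : G b t != 0 by rewrite gt_eqF.
pose mix (s : seq I) := [ffun j => if j \in s then y j else t j].
have step (s : seq I) : uniq s ->
    G b (mix s) = G b t * \prod_(i <- s | bd i) (G b (update t i (y i)) / G b t).
  elim: s => [_|i s IH].
    by rewrite big_nil mulr1; congr (G b _); apply/ffunP => j; rewrite ffunE.
  rewrite cons_uniq => /andP[si us]; rewrite big_cons.
  have mixE : update (mix (i :: s)) i (t i) = mix s.
    apply/ffunP => j; rewrite !ffunE inE; case: eqP => //= ->.
    by rewrite (negPf si).
  case: ifP => bi.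
    rewrite mulrCA -IH //; apply: (mulIf Gt0); rewrite mulrAC divfK // mulrC.
    by rewrite mulrC (G_swap _ _ _ i) mixE mulrC; congr (G b (update t i _) * _);
       rewrite ffunE inE eqxx.
  by rewrite -IH // -mixE G_const // bi.
have := step (index_enum I) (index_enum_uniq I); congr (G b _ = _).
by apply/ffunP => j; rewrite ffunE mem_index_enum.
Qed.

(* [m i b] is the message at [i] conditioned on the exterior [b]; [mh i] is its
   analogue computed from the unconditioned law on the region. *)
Let m i b a := H i b a / h i b.
Let gam i a := PU (update t i a) / Phi (update t i a).
Let mh i a := gam i a / \sum_a gam i a.

Lemma region_weight_update_gt0 i a : 0 < Phi (update t i a).
Proof. by apply: lt_le_trans (Phi_upd i a); exact: mulr_gt0. Qed.

Lemma region_ge0 y : 0 <= PU y.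
Proof. by apply: sumr_ge0 => b _; exact: joint_ge0. Qed.

Lemma reference_mass i : beta' / M <= \sum_a gam i a.
Proof.
have gam0 a : 0 <= gam i a.
  by rewrite mulr_ge0 ?region_ge0 // invr_ge0 ltW // region_weight_update_gt0.
apply: (@le_trans _ _ (gam i (t i))); last first.
  by rewrite (bigD1 (t i)) //= lerDl sumr_ge0.
rewrite /gam update_id; apply: ler_pM.
- exact: ltW.
- by rewrite invr_ge0 ltW.
- rewrite -[leLHS]mulr1 -J_sum mulr_sumr; exact: ler_sum.
- rewrite lef_pV2 ?posrE //; apply: lt_le_trans Phi_t; exact: mulr_gt0.
Qed.

(** The exchange relation between [H] and [G] makes the two sides proportional
    as functions of [a].  The right-hand side involves only [G b], which is the
    law on the region divided by the explicit weight [Phi]. *)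
Lemma conditional_message_weight i b a : bd i -> 0 < PB b ->
  m i b a = G b (update t i a) / \sum_a G b (update t i a).
Proof.
move=> bi bpos; have Gt0 : G b t != 0 by rewrite gt_eqF // reference_weight_gt0.
have hpos := H_gt0 bi bpos.
have Ht0 : H i b (t i) != 0.
  by rewrite gt_eqF //; apply: lt_le_trans (H_t b bi); exact: mulr_gt0.
have HE c : H i b c = H i b (t i) / G b t * G b (update t i c).
  by apply: (mulIf Gt0); rewrite H_swap // mulrAC divfK.
rewrite /m HE {1}/h (eq_bigr _ (fun c _ => HE c)) -mulr_sumr.
have : \sum_c G b (update t i c) != 0.
  apply: contraTneq hpos => S0.
  by rewrite /h (eq_bigr _ (fun c _ => HE c)) -mulr_sumr S0 mulr0 ltxx.
by move=> S0; field; rewrite S0 Gt0 Ht0.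
Qed.

Lemma conditional_message_dist i b : bd i -> 0 < PB b ->
  \sum_a `|m i b a - mh i a| <= 2 * q / (lam * beta') * (Er b / PB b).
Proof.
move=> bi bpos.
have S_gt0 : 0 < \sum_a gam i a.
  by apply: lt_le_trans (reference_mass i); rewrite divr_gt0.
have gam0 a : 0 <= gam i a.
  by rewrite mulr_ge0 ?region_ge0 // invr_ge0 ltW // region_weight_update_gt0.
have := @normalize_dist R X (fun a => PB b * gam i a)
  (fun a => G b (update t i a)).
rewrite -mulr_sumr => /(_ (fun a => mulr_ge0 (exterior_ge0 b) (gam0 a))
   (fun a => G_ge0 b _) (mulr_gt0 bpos S_gt0)).
rewrite (eq_bigr (fun a => `|m i b a - mh i a|)) => [|a _]; last first.
  rewrite conditional_message_weight // /mh distrC; congr `|_ - _|.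
  by rewrite -mulf_div divff ?mul1r // gt_eqF.
move/le_trans; apply.
have termE a : `|PB b * gam i a - G b (update t i a)| <= Er b / (lam * M).
  have P0 := region_weight_update_gt0 i a.
  rewrite (_ : _ - _ = - (J (update t i a) b - PU (update t i a) * PB b)
     / Phi (update t i a)); last by rewrite /gam /J; field; rewrite gt_eqF.
  rewrite normrM normrN [`|_^-1|]gtr0_norm ?invr_gt0 //; apply: ler_pM => //.
  - by rewrite invr_ge0 ltW.
  - by rewrite /Er (bigD1 (update t i a)) //= lerDl sumr_ge0.
  - by rewrite lef_pV2 ?posrE // mulr_gt0.
have sumE : \sum_a `|PB b * gam i a - G b (update t i a)| <= q * (Er b / (lam * M)).
  apply: (le_trans (ler_sum _ (fun a _ => termE a))).
  by rewrite sumr_const -[q]/(#|X|%:R) mulr_natl.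
have [M0 l0 b0 p0] : [/\ M != 0, lam != 0, beta' != 0 & PB b != 0].
  by split; rewrite gt_eqF.
rewrite (_ : _ * (Er b / PB b) =
   2 * (q * (Er b / (lam * M))) / (PB b * (beta' / M))); last first.
  by field; rewrite M0 l0 b0 p0.
apply: ler_pM.
- by rewrite mulr_ge0 // sumr_ge0.
- by rewrite invr_ge0 mulr_ge0 // ltW.
- by rewrite ler_pM2l.
- rewrite lef_pV2 ?posrE ?mulr_gt0 ?invr_gt0 //.
  by rewrite ler_pM2l // reference_mass.
Qed.

(** The averaged message is the mean of the conditional ones for weights [h i b]
    that are at most [K] times the probability of the exterior [b], so that the
    average of the deviations is controlled by [decorrelated]. *)
Lemma averaged_message_dist i : bd i ->
  \sum_a `|n i a - mh i a| <= 2 * q / (lam * beta') * (K * d).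
Proof.
move=> bi; set c := 2 * q / _.
have c0 : 0 <= c by rewrite !mulr_ge0 ?ler0n // invr_ge0 mulr_ge0 ?ltW.
have nE a : n i a - mh i a = \sum_b (H i b a - h i b * mh i a).
  by rewrite sumrB -mulr_suml H_sum // mul1r.
rewrite (eq_bigr _ (fun a _ => congr1 Num.norm (nE a))).
apply: (le_trans (ler_sum _ (fun a _ => ler_norm_sum _ _ _))).
rewrite exchange_big /=.
apply: (@le_trans _ _ (\sum_b c * (K * Er b))); last first.
  by rewrite -mulr_sumr ler_wpM2l // -mulr_sumr ler_wpM2l.
apply: ler_sum => b _.
have h0 : 0 <= h i b by apply: sumr_ge0 => a _; exact: H_ge0.
have [bpos|] := ltP 0 (PB b).
  have hpos := H_gt0 bi bpos.
  rewrite (eq_bigr (fun a => h i b * `|m i b a - mh i a|)) => [|a _]; last first.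
    rewrite -{2}(ger0_norm h0) -normrM mulrBr; congr `|_ - _|.
    by rewrite /m mulrCA mulfV ?mulr1 // gt_eqF.
  rewrite -mulr_sumr.
  rewrite (_ : c * (K * Er b) = (K * PB b) * (c * (Er b / PB b))); last first.
    by field; rewrite gt_eqF.
  apply: ler_pM => //; [exact: sumr_ge0 | exact: H_le | exact: conditional_message_dist].
rewrite le_eqVlt ltNge exterior_ge0 orbF => /eqP PB0.
have hE : h i b = 0.
  by apply/eqP; rewrite eq_le h0 andbT -(mulr0 K) -PB0 H_le.
rewrite big1; first exact: (mulr_ge0 c0 (mulr_ge0 K_ge0 (correlation_ge0 b))).
move=> a _; rewrite hE mul0r subr0.
have /psumr_eq0P -> // : \sum_a H i b a = 0 by [].
  by rewrite normr0.
by move=> a' _; exact: H_ge0.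
Qed.

Let f b y := Phi y * \prod_(i | bd i) m i b (y i).
Let g y := Phi y * \prod_(i | bd i) n i (y i).
Let N := #|[pred i | bd i]|.

Lemma conditional_message_bounds i b a : bd i -> 0 < PB b -> 0 <= m i b a <= 1.
Proof.
move=> bi bpos; have hpos := H_gt0 bi bpos; apply/andP; split.
  by rewrite divr_ge0 ?H_ge0 // ltW.
by rewrite ler_pdivrMr // mul1r /h (bigD1 a) //= lerDl sumr_ge0 // => *; exact: H_ge0.
Qed.

Lemma averaged_message_bounds i a : bd i -> 0 <= n i a <= 1.
Proof.
move=> bi; apply/andP; split; first by apply: sumr_ge0 => b _; exact: H_ge0.
rewrite -(H_sum bi); apply: ler_sum => b _.
by rewrite /h (bigD1 a) //= lerDl sumr_ge0 // => *; exact: H_ge0.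
Qed.

(** At a fixed exterior configuration the law on the region is exactly a Bethe
    measure, with the conditional messages. *)
Lemma conditional_product b : 0 < PB b ->
  exists2 c, 0 < c & forall y, f b y = c * J y b.
Proof.
move=> bpos; have Gt := reference_weight_gt0 bpos; have Gt0 : G b t != 0 by rewrite gt_eqF.
exists ((\prod_(i | bd i) m i b (t i)) / G b t).
  rewrite divr_gt0 // prodr_gt0 // => i bi.
  have hpos := H_gt0 bi bpos; rewrite divr_gt0 //.
  by apply: lt_le_trans (H_t b bi); exact: mulr_gt0.
move=> y; rewrite /f /J mulrCA; congr (_ * _).
rewrite [in RHS](exterior_weight_factor y bpos) mulrA divfK // -big_split /=.
apply: eq_bigr => i bi; rewrite /m mulrAC; congr (_ / _).
by apply: (mulIf Gt0); rewrite -[RHS]mulrA divfK // H_swap.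
Qed.

(** At a good exterior [b] the law on the region is close to the conditional
    one, which is the normalisation of [f b]; and [f b] is close to [g] because
    the conditional messages at [b] are close to the averaged ones. *)
Lemma bethe_estimate :
  \sum_y `|PU y - g y / \sum_y g y| <=
  d * (1 + N%:R * (4 * q ^+ #|I|.+1 * (1 + K) / (lam ^+ 2 * beta' * beta ^+ N))).
Proof.
have [b bpos bEr] := good_exterior.
have [c c0 fE] := conditional_product bpos.
have f0 y : 0 <= f b y by rewrite fE mulr_ge0 ?joint_ge0 // ltW.
have g0 y : 0 <= g y.
  by rewrite mulr_ge0 // prodr_ge0 // => i bi; case/andP: (averaged_message_bounds (y i) bi).
have fS : \sum_y f b y = c * PB b by rewrite (eq_bigr _ (fun y _ => fE y)) -mulr_sumr.
have JE y : J y b / PB b = f b y / \sum_y f b y.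
  by rewrite fS fE; field; rewrite !gt_eqF.
have lamb : lam * M * beta ^+ N <= \sum_y f b y.
  apply: (@le_trans _ _ (f b t)); last by rewrite (bigD1 t) //= lerDl sumr_ge0.
  apply: ler_pM => //; [by rewrite mulr_ge0 // ltW | by rewrite exprn_ge0 // ltW |].
  rewrite /N -prodr_const; apply: ler_prod => i bi.
  by rewrite ltW //= ler_pdivlMr ?H_t // H_gt0.
have lamb0 : 0 < lam * M * beta ^+ N by rewrite !mulr_gt0 // exprn_gt0.
have S0 := lt_le_trans lamb0 lamb.
apply: (@le_trans _ _ (\sum_y (`|PU y - J y b / PB b| +
    `|f b y / \sum_y f b y - g y / \sum_y g y|))).
  apply: ler_sum => y _; rewrite -JE.
  by rewrite (_ : _ - _ = (PU y - J y b / PB b) + (J y b / PB b - g y / \sum_y g y))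
    ?ler_normD // addrA subrK.
rewrite big_split /= mulrDr mulr1; apply: lerD.
  rewrite (eq_bigr (fun y => `|J y b - PU y * PB b| / PB b)) => [|y _].
    by rewrite -mulr_suml ler_pdivrMr.
  rewrite (_ : PU y - _ = - (J y b - PU y * PB b) / PB b); last first.
    by field; rewrite gt_eqF.
  by rewrite normrM normrN [`|_^-1|]gtr0_norm ?invr_gt0.
apply: (le_trans (normalize_dist f0 g0 S0)).
set ep := 2 * q / (lam * beta') * ((1 + K) * d).
have mn i : bd i -> \sum_a `|m i b a - n i a| <= ep.
  move=> bi; apply: (@le_trans _ _ (\sum_a (`|m i b a - mh i a| + `|n i a - mh i a|))).
    apply: ler_sum => a _; rewrite [`|n i a - _|]distrC.
    by rewrite (_ : m i b a - n i a = (m i b a - mh i a) + (mh i a - n i a))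
      ?ler_normD // addrA subrK.
  rewrite big_split /= /ep [(1 + K) * d]mulrDl mul1r mulrDr.
  apply: lerD; last exact: averaged_message_dist.
  apply: le_trans (conditional_message_dist bi bpos) _; apply: ler_wpM2l.
    by rewrite !mulr_ge0 ?ler0n // invr_ge0 mulr_ge0 ?ltW.
  by rewrite ler_pdivrMr.
have fg : \sum_y `|f b y - g y| <= q ^+ #|I| * (M * (N%:R * ep)).
  apply: (@le_trans _ _ (\sum_(y : {ffun I -> X}) M * (N%:R * ep))); last first.
    by rewrite sumr_const card_ffun -[leLHS]mulr_natl natrX.
  apply: ler_sum => y _; rewrite -mulrBr normrM ger0_norm //; apply: ler_pM => //.
  apply: (le_trans (prod_dist _ _ _)).
  - by move=> i bi; exact: conditional_message_bounds.
  - by move=> i bi; exact: averaged_message_bounds.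
  rewrite mulr_natl /N -sumr_const; apply: ler_sum => i bi.
  by apply: le_trans (mn i bi); rewrite (bigD1 (y i)) //= lerDl sumr_ge0.
have fg0 : 0 <= \sum_y `|f b y - g y| by apply: sumr_ge0.
apply: (@le_trans _ _ (2 * (q ^+ #|I| * (M * (N%:R * ep))) / (lam * M * beta ^+ N))).
  apply: ler_pM; rewrite ?invr_ge0 ?mulr_ge0 ?(ltW S0) //.
    by rewrite ler_pM2l.
  by rewrite lef_pV2 // posrE.
rewrite le_eqVlt; apply/orP; left; apply/eqP; rewrite /ep exprS.
have bN : beta ^+ N != 0 by rewrite gt_eqF // exprn_gt0.
by field; rewrite bN !gt_eqF.
Qed.

End ConditionalIndependence.

(** * Exchanging two configurations on a set of vertices *)
Section Exchange.
Variables (V X : finType).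
Implicit Types (C B : {set V}) (x : {ffun V -> X}).

Definition exchange C x x' : {ffun V -> X} :=
  [ffun v => if v \in C then x' v else x v].

Lemma exchangeK C x x' : exchange C (exchange C x x') (exchange C x' x) = x.
Proof. by apply/ffunP => v; rewrite !ffunE; case: (v \in C). Qed.

Lemma restrict_exchange_agree C B x x' :
  restrict B x = restrict B x' -> restrict B (exchange C x x') = restrict B x.
Proof.
move=> /ffunP xx'; apply/ffunP => i; rewrite !ffunE; case: ifP => // _.
by have := xx' i; rewrite !ffunE.
Qed.

Lemma restrict_exchange_disjoint (A C : {set V}) x x' :
  (forall i, i \in C -> i \notin A) -> restrict C (exchange A x x') = restrict C x.
Proof.
move=> dis; apply/ffunP => i; rewrite !ffunE.
by rewrite (negPf (dis _ (valP i))).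
Qed.

Lemma restrict_exchange_one C (U : {set V}) x x' (i : {i | i \in U}) :
    (forall j, j \in U -> (j \in C) = (j == val i)) ->
  restrict U (exchange C x x') = update (restrict U x) i (x' (val i)).
Proof.
move=> CU; apply/ffunP => j; rewrite !ffunE (CU _ (valP j)).
case: (j =P i) => [->|ji]; first by rewrite eqxx.
by case: eqP => // /val_inj.
Qed.

(** Exchanging is an involution on pairs of configurations, hence a change of
    variables in the product of two sums.  All the conditional independence
    used below comes out of this identity. *)
Lemma exchange_sums (R : comPzRingType) C (w1 w2 w1' w2' : {ffun V -> X} -> R)
    (D1 D2 D1' D2' : pred {ffun V -> X}) :
    (forall x x', D1 x -> D2 x' ->
       [/\ D1' (exchange C x x'), D2' (exchange C x' x)
         & w1 x * w2 x' = w1' (exchange C x x') * w2' (exchange C x' x)]) ->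
    (forall x x', D1' x -> D2' x' ->
       D1 (exchange C x x') /\ D2 (exchange C x' x)) ->
  (\sum_(x | D1 x) w1 x) * (\sum_(x | D2 x) w2 x)
    = (\sum_(x | D1' x) w1' x) * (\sum_(x | D2' x) w2' x).
Proof.
move=> to_ from_; rewrite !big_distrlr /= !pair_big /=.
pose ex (p : {ffun V -> X} * {ffun V -> X}) :=
  (exchange C p.1 p.2, exchange C p.2 p.1).
have exK : involutive ex by move=> [x x']; rewrite /ex /= !exchangeK.
rewrite [RHS](reindex_inj (inv_inj exK)) /=.
apply: eq_big => [[x x']|[x x'] /andP[/= D1x D2x]] /=; last first.
  by case: (to_ _ _ D1x D2x).
apply/andP/andP => [[D1x D2x]|[/from_ h /h]]; first by case: (to_ _ _ D1x D2x).
by rewrite !exchangeK.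
Qed.

End Exchange.

(** * Gibbs weights and the exchange *)
Section Weights.
Variables (R : realType) (V X : finType).
Variables (psie : V -> V -> X -> X -> R) (psiv : V -> X -> R).
Implicit Types (C B : {set V}) (x : {ffun V -> X}) (e : rel V).

Definition edge_weight (P : pred (V * V)) x : R :=
  \prod_(p | P p) psie p.1 p.2 (x p.1) (x p.2).

Definition site_weight (Q : pred V) x : R := \prod_(i | Q i) psiv i (x i).

Definition oriented (e : rel V) : pred (V * V) :=
  [pred p | e p.1 p.2 && (enum_rank p.1 < enum_rank p.2)%N].

Lemma gibbs_weightE e x :
  gibbs_weight e psie psiv x = edge_weight (oriented e) x * site_weight predT x.
Proof. by []. Qed.

(** Provided that no edge joins [C] to the outside of [C] and [B], an edge sees
    either both of its ends exchanged or none, up to ends in [B], where the two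
    configurations agree. *)
Lemma edge_weight_exchange (P : pred (V * V)) C B x x' :
    restrict B x = restrict B x' ->
    (forall p, P p ->
       (p.1 \in C) && ((p.2 \in C) || (p.2 \in B)) ||
       (p.2 \in C) && ((p.1 \in C) || (p.1 \in B)) ||
       (p.1 \notin C) && (p.2 \notin C)) ->
  edge_weight P x * edge_weight P x'
    = edge_weight P (exchange C x x') * edge_weight P (exchange C x' x).
Proof.
move=> /ffunP xB PC; rewrite /edge_weight -!big_split; apply: eq_bigr => p Pp /=.
have xBE v : v \in B -> x v = x' v.
  by move=> vB; have := xB (exist _ v vB); rewrite !ffunE.
rewrite !ffunE; have := PC p Pp.
case: ifP => p1; case: ifP => p2 //=; rewrite ?orbF; first by rewrite mulrC.
  by move=> /xBE ->; rewrite mulrC.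
by move=> /xBE ->; rewrite mulrC.
Qed.

Lemma site_weight_exchange (Q : pred V) C x x' :
  site_weight Q x * site_weight Q x'
    = site_weight Q (exchange C x x') * site_weight Q (exchange C x' x).
Proof.
rewrite /site_weight -!big_split; apply: eq_bigr => i _ /=.
by rewrite !ffunE; case: ifP => // _; rewrite mulrC.
Qed.

Lemma edge_weight_eq (P : pred (V * V)) x x' :
  (forall p, P p -> x p.1 = x' p.1 /\ x p.2 = x' p.2) ->
  edge_weight P x = edge_weight P x'.
Proof. by move=> xx'; apply: eq_bigr => p /xx' [-> ->]. Qed.

Lemma site_weight_eq (Q : pred V) x x' :
  (forall i, Q i -> x i = x' i) -> site_weight Q x = site_weight Q x'.
Proof. by move=> xx'; apply: eq_bigr => i /xx' ->. Qed.

Lemma del_edge_weight e (i u : V) x :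
    symmetric e -> irreflexive e -> e i u ->
    (forall k l, e k l -> forall a b, psie k l a b = psie l k b a) ->
  gibbs_weight e psie psiv x
    = gibbs_weight (del_edge e i u) psie psiv x * psie i u (x i) (x u).
Proof.
move=> e_sym e_irr iu psi_sym; rewrite !gibbs_weightE mulrAC; congr (_ * _).
have iu_neq : i != u by apply: contraTneq iu => ->; rewrite e_irr.
have ranks : (enum_rank i < enum_rank u)%N || (enum_rank u < enum_rank i)%N.
  by rewrite -neq_ltn; apply: contraNneq iu_neq => /ord_inj/enum_rank_inj ->.
pose p0 := if (enum_rank i < enum_rank u)%N then (i, u) else (u, i).
have p0P : oriented e p0.
  move: ranks; rewrite /p0; case: ifP => [lt_iu _|_ /= lt_ui] /=.
    by rewrite /oriented /= iu lt_iu.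
  by rewrite /oriented /= e_sym iu lt_ui.
rewrite /edge_weight (bigD1 p0) //= mulrC; congr (_ * _); last first.
  rewrite /p0; case: ifP => _ //=; by rewrite psi_sym // e_sym.
apply: eq_bigl => -[k l]; rewrite /oriented /=.
rewrite -!andbA; congr (_ && _); rewrite andbC.
case kl: (enum_rank k < enum_rank l)%N; rewrite ?andbF ?andbT //; congr (~~ _).
have kl_neq : k != l by apply: contraTneq kl => ->; rewrite ltnn.
apply/eqP/eqP => [|klE].
  by rewrite /p0; case: ifP => _ [-> ->] //; rewrite finset.setUC.
have : k \in [set i; u] by rewrite -klE !inE eqxx.
have : l \in [set i; u] by rewrite -klE !inE eqxx orbT.
rewrite /p0 !inE => /orP[]/eqP lE /orP[]/eqP kE; subst k l;
  rewrite ?eqxx // in kl_neq *; first by rewrite ltnNge ltnW.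
by rewrite kl.
Qed.

End Weights.

(** * Independence of the orientation of the edges *)
Section Orientation.
Variable R : comPzRingType.

(** Reversing the pairs on which the two rankings disagree is a bijection
    between the two index sets. *)
Lemma orientation_indep (V : finType) (e : rel V) (F : V -> V -> R)
    (r1 r2 : V -> nat) :
    symmetric e -> (forall k l, e k l -> F k l = F l k) ->
    injective r1 -> injective r2 ->
  \prod_(p : V * V | e p.1 p.2 && (r1 p.1 < r1 p.2)%N) F p.1 p.2
    = \prod_(p : V * V | e p.1 p.2 && (r2 p.1 < r2 p.2)%N) F p.1 p.2.
Proof.
move=> e_sym F_sym r1_inj r2_inj.
have total (r : V -> nat) k l : injective r -> k != l ->
    (r l < r k)%N = ~~ (r k < r l)%N.
  move=> r_inj kl; rewrite -leqNgt [RHS]leq_eqVlt; case: eqP => // /r_inj lk.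
  by rewrite lk eqxx in kl.
pose h (p : V * V) :=
  if (r1 p.1 < r1 p.2)%N == (r2 p.1 < r2 p.2)%N then p else (p.2, p.1).
have hK : involutive h.
  move=> [k l]; rewrite /h /=.
  case E: (_ == (r2 k < r2 l)%N); rewrite /= ?E //.
  have [klE|kl] := eqVneq k l; first by rewrite klE !ltnn in E.
  by rewrite (total r1 k l) // (total r2 k l) // (inj_eq negb_inj) E.
rewrite (reindex_inj (inv_inj hK)) /=; apply: eq_big => -[k l]; rewrite /h /=.
  have [->|kl] := eqVneq k l; first by rewrite !ltnn /= ?ltnn ?andbF.
  case: (boolP (_ == _)) => [/eqP /= ->//|/=]; rewrite (total r1 k l) // e_sym.
  by case: (r1 k < r1 l)%N; case: (r2 k < r2 l)%N.
by case: ifP => //= _ /andP[lk _]; exact: F_sym.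
Qed.

Lemma prod_sub_pairs (V : finType) (U : {set V}) (P : pred (V * V))
    (F : V * V -> R) :
  \prod_(p | P p && ((p.1 \in U) && (p.2 \in U))) F p
    = \prod_(p : {i | i \in U} * {i | i \in U} | P (val p.1, val p.2))
        F (val p.1, val p.2).
Proof.
transitivity (\prod_(k in U) \prod_(l in U | P (k, l)) F (k, l)).
  rewrite pair_big_dep; apply: eq_big => -[k l] //=.
  by rewrite andbC andbA.
transitivity (\prod_(k : {i | i \in U})
    \prod_(l : {i | i \in U} | P (val k, val l)) F (val k, val l)).
  by rewrite big_sub; apply: eq_bigr => k _; rewrite big_sub_cond.
by rewrite pair_big_dep.
Qed.

End Orientation.

(** * Permitted states have probability bounded below *)
Section Permissive.
Variables (R : realType) (V X : finType) (e : rel V).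
Variables (psie : V -> V -> X -> X -> R) (psiv : V -> X -> R) (psimax kappa : R).
Hypothesis e_sym : symmetric e.
Hypothesis (bounded : bounded_spec e psie psiv psimax).
Hypotheses (kappa_gt0 : 0 < kappa) (kappa_le1 : kappa <= 1).
Hypothesis (psiv_ge : forall i a, kappa * psimax <= psiv i a).
Variable xp : V -> X.
Hypothesis (psie_ge : forall i j, e i j -> forall a,
  kappa * psimax <= psie i j (xp i) a /\ kappa * psimax <= psie i j a (xp j)).

Let Delta := max_degree e.

(** Each edge that touches [A] keeps a factor of at least [kappa * psimax] when
    [A] is overwritten by [z]. *)
Definition shielded (A : {set V}) (z : {ffun V -> X}) :=
  forall k l, e k l -> k \in A -> z k = xp k \/ (l \in A /\ z l = xp l).

Lemma psimax_gt0 : 0 < psimax.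
Proof. by case: bounded. Qed.

Lemma psie_bounds i j a b : e i j -> 0 <= psie i j a b <= psimax.
Proof. by case: bounded => _ h _ _ ij; exact: h. Qed.

Lemma psie_sym i j a b : e i j -> psie i j a b = psie j i b a.
Proof. by case: bounded => _ _ h _ ij; exact: h. Qed.

Lemma psiv_bounds i a : 0 <= psiv i a <= psimax.
Proof. by case: bounded. Qed.

Lemma psiv_gt0 i a : 0 < psiv i a.
Proof. by apply: lt_le_trans (psiv_ge i a); rewrite mulr_gt0 ?psimax_gt0. Qed.

Lemma gibbs_weight_ge0 (e0 : rel V) x :
  subrel e0 e -> 0 <= gibbs_weight e0 psie psiv x.
Proof.
move=> e0e; rewrite gibbs_weightE mulr_ge0 // prodr_ge0 // => [p|i _].
  by case/andP => /e0e/(psie_bounds (x p.1) (x p.2))/andP[].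
exact/ltW/psiv_gt0.
Qed.

Lemma card_touching (A : {set V}) :
  (#|[pred p : V * V | e p.1 p.2 && ((p.1 \in A) || (p.2 \in A))]|
     <= 2 * Delta * #|A|)%N.
Proof.
have half : (#|[pred p : V * V | e p.1 p.2 && (p.1 \in A)]| <= Delta * #|A|)%N.
  have -> : #|[pred p : V * V | e p.1 p.2 && (p.1 \in A)]|
      = (\sum_(k in A) \sum_(l in nbhd e k) 1)%N.
    rewrite pair_big_dep sum1_card; apply: eq_card => p.
    by rewrite !inE [in RHS]unfold_in /= inE andbC.
  rewrite mulnC -sum_nat_const; apply: leq_sum => k _; rewrite sum1_card.
  exact: (leq_bigmax (F := fun k => #|nbhd e k|)).
have swapE : #|[pred p : V * V | e p.1 p.2 && (p.2 \in A)]|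
    = #|[pred p : V * V | e p.1 p.2 && (p.1 \in A)]|.
  have swapK : involutive (fun p : V * V => (p.2, p.1)) by case.
  rewrite -sum1_card (reindex_inj (inv_inj swapK)) sum1_card /=.
  by apply: eq_card => p; rewrite !inE /= e_sym.
rewrite -mulnA mul2n -addnn.
apply: (@leq_trans (#|[pred p : V * V | e p.1 p.2 && (p.1 \in A)]| +
   #|[pred p : V * V | e p.1 p.2 && (p.2 \in A)]|)); last first.
  by rewrite swapE leq_add.
rewrite -cardUI; apply: leq_trans (leq_addr _ _); apply: subset_leq_card.
by apply/fintype.subsetP => p; rewrite !inE andb_orr.
Qed.

(** The cost of overwriting one vertex: two factors for each of the at most
    [Delta] edges at that vertex, since [card_touching] counts both orders of
    the ends, and one for the vertex itself. *)
Definition cost : R := kappa ^+ (2 * Delta + 1).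

Lemma exchange_permitted (e0 : rel V) (A : {set V}) (z x : {ffun V -> X}) :
    subrel e0 e -> shielded A z ->
  cost ^+ #|A| * gibbs_weight e0 psie psiv x
    <= gibbs_weight e0 psie psiv (exchange A x z).
Proof.
move=> e0e sh; rewrite !gibbs_weightE /cost -exprM mulnDl mul1n exprD mulrACA.
have ew0 : 0 <= edge_weight psie (oriented e0) x.
  by apply: prodr_ge0 => p /andP[/e0e/(psie_bounds (x p.1) (x p.2))/andP[]].
have sw0 : 0 <= site_weight psiv predT x.
  by apply: prodr_ge0 => i _; exact/ltW/psiv_gt0.
apply: ler_pM; rewrite ?mulr_ge0 ?exprn_ge0 // ?(ltW kappa_gt0) //.
  pose touch (p : V * V) := (p.1 \in A) || (p.2 \in A).
  apply: (@le_trans _ _ ((\prod_(p | oriented e0 p) (if touch p then kappa else 1))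
     * edge_weight psie (oriented e0) x)).
    apply: ler_wpM2r => //; rewrite -big_mkcondr /= prodr_const.
    apply: ler_wiXn2l => //; first exact: ltW.
    apply: leq_trans (card_touching A); apply: subset_leq_card.
    by apply/fintype.subsetP => p; rewrite !inE => /andP[/andP[/e0e -> _]].
  rewrite /edge_weight -big_split /=; apply: ler_prod => p /andP[/e0e ep _].
  have /andP[p0 pm] := psie_bounds (x p.1) (x p.2) ep.
  have permitted : (p.1 \in A) && (z p.1 == xp p.1) ||
      (p.2 \in A) && (z p.2 == xp p.2) ->
      kappa * psie p.1 p.2 (x p.1) (x p.2)
       <= psie p.1 p.2 (exchange A x z p.1) (exchange A x z p.2).
    move=> h; apply: (@le_trans _ _ (kappa * psimax)).
      by rewrite ler_pM2l.
    rewrite !ffunE; case/orP: h => /andP[-> /eqP ->].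
      by case: (psie_ge ep (if p.2 \in A then z p.2 else x p.2)).
    by case: (psie_ge ep (if p.1 \in A then z p.1 else x p.1)).
  rewrite /touch; case: ifP => [tp|/negbT]; last first.
    rewrite negb_or mul1r !ffunE => /andP[/negPf -> /negPf ->].
    by rewrite p0 lexx.
  rewrite mulr_ge0 ?(ltW kappa_gt0) //=; apply: permitted.
  case/orP: tp => pA.
    by case: (sh _ _ ep pA) => [->|[-> ->]]; rewrite ?pA eqxx ?orbT.
  rewrite e_sym in ep; case: (sh _ _ ep pA) => [->|[-> ->]];
    by rewrite ?pA eqxx ?orbT.
apply: (@le_trans _ _ ((\prod_(i in V) (if i \in A then kappa else 1))
     * site_weight psiv predT x)).
  by rewrite -big_mkcondr /= prodr_const.
rewrite /site_weight -big_split /=; apply: ler_prod => i _.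
have i0 := ltW (psiv_gt0 i (x i)); rewrite ffunE; case: ifP => _; last first.
  by rewrite mul1r i0 lexx.
rewrite mulr_ge0 ?(ltW kappa_gt0) //=; apply: le_trans (psiv_ge i (z i)).
by rewrite ler_pM2l //; case/andP: (psiv_bounds i (x i)).
Qed.

Lemma card_exchange_fibre (A : {set V}) (z x' : {ffun V -> X}) :
  (#|[pred x | exchange A x z == x']| <= #|X| ^ #|A|)%N.
Proof.
have <- : #|{ffun {i | i \in A} -> X}| = (#|X| ^ #|A|)%N.
  by rewrite card_ffun card_sig.
have inj : {in [pred x | exchange A x z == x'] &, injective (restrict A)}.
  move=> x y; rewrite !inE => /eqP/ffunP xE /eqP/ffunP yE /ffunP xy.
  apply/ffunP => v; case: (boolP (v \in A)) => vA.
    by have := xy (exist _ v vA); rewrite !ffunE.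
  by have := xE v; rewrite -yE !ffunE (negPf vA).
by rewrite -(card_in_imset inj); exact: max_card.
Qed.

Definition permit_prob : R := cost / #|X|%:R.

(** Overwriting [A] by [z] lowers the weight by at most [cost ^+ #|A|], and at
    most [#|X| ^ #|A|] configurations become the same one. *)
Lemma permitted_sum (e0 : rel V) (A : {set V}) (z : {ffun V -> X})
    (Q : pred {ffun V -> X}) :
    subrel e0 e -> shielded A z -> (0 < #|X|)%N ->
    (forall x, Q x -> Q (exchange A x z)) ->
  permit_prob ^+ #|A| * (\sum_(x | Q x) gibbs_weight e0 psie psiv x)
    <= \sum_(x | Q x && [forall i in A, x i == z i]) gibbs_weight e0 psie psiv x.
Proof.
move=> e0e sh X0 Qex; set w := gibbs_weight e0 psie psiv.
have w0 x : 0 <= w x by exact: gibbs_weight_ge0.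
rewrite expr_div_n mulrAC ler_pdivrMr ?exprn_gt0 ?ltr0n //.
rewrite mulr_sumr; apply: (@le_trans _ _ (\sum_(x | Q x) w (exchange A x z))).
  by apply: ler_sum => x _; exact: exchange_permitted.
rewrite (partition_big (fun x => exchange A x z)
   (fun x => Q x && [forall i in A, x i == z i])) /= => [|x Qx]; last first.
  by rewrite Qex //=; apply/forall_inP => i iA; rewrite ffunE iA.
rewrite mulr_suml; apply: ler_sum => x' _.
rewrite (eq_bigr (fun _ => w x')) => [|x /andP[_ /eqP ->] //].
rewrite sumr_const -[leLHS]mulr_natr; apply: ler_wpM2l => //.
rewrite -natrX ler_nat; apply: leq_trans (card_exchange_fibre A z x').
by apply: subset_leq_card; apply/fintype.subsetP => x; rewrite !inE => /andP[].
Qed.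

Lemma shielded_permitted (A : {set V}) : shielded A [ffun v => xp v].
Proof. by move=> k l _ _; left; rewrite ffunE. Qed.

Lemma permitted_weight_gt0 (e0 : rel V) : subrel e0 e ->
  0 < gibbs_weight e0 psie psiv [ffun v => xp v].
Proof.
move=> e0e; rewrite gibbs_weightE mulr_gt0 // prodr_gt0 // => [p /andP[/e0e ep _]|i _].
  rewrite !ffunE; case: (psie_ge ep (xp p.2)) => h _.
  by apply: lt_le_trans h; rewrite mulr_gt0 ?psimax_gt0.
exact: psiv_gt0.
Qed.

Lemma partition_gt0 (e0 : rel V) : subrel e0 e -> 0 < partition_fun e0 psie psiv.
Proof.
move=> e0e; rewrite /partition_fun (bigD1 [ffun v => xp v]) //=.
apply: ltr_wpDr; first by apply: sumr_ge0 => x _; exact: gibbs_weight_ge0.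
exact: permitted_weight_gt0.
Qed.

Lemma gibbs_distr (e0 : rel V) : subrel e0 e -> is_distr (gibbs e0 psie psiv).
Proof.
move=> e0e; have Z0 := partition_gt0 e0e; split=> [x|].
  by rewrite divr_ge0 ?gibbs_weight_ge0 // ltW.
by rewrite -mulr_suml divff // gt_eqF.
Qed.

End Permissive.

(** * Factorisation of the Gibbs measure at a region *)
Section MarginalSums.
Variables (R : realType) (V X : finType) (rho : {ffun V -> X} -> R).
Variables (A B : {set V}).

Lemma joint_marginal_sumr y :
  \sum_b joint_marginal rho A B (y, b) = marginal rho A y.
Proof.
rewrite /marginal (partition_big (fun x => restrict B x) xpredT) //=.
Qed.

Lemma joint_marginal_suml b :
  \sum_y joint_marginal rho A B (y, b) = marginal rho B b.
Proof.
rewrite /marginal (partition_big (fun x => restrict A x) xpredT) //=.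
by apply: eq_bigr => y _; apply: eq_bigl => x; rewrite andbC.
Qed.

Lemma marginal_sum : \sum_y marginal rho A y = \sum_x rho x.
Proof. by rewrite [RHS](partition_big (fun x => restrict A x) xpredT). Qed.

Lemma restrict_eqE x (z : {ffun V -> X}) :
  (restrict A x == restrict A z) = [forall i in A, x i == z i].
Proof.
apply/eqP/forall_inP => [/ffunP xz i iA|xz].
  by have := xz (exist _ i iA); rewrite !ffunE => ->.
by apply/ffunP => i; rewrite !ffunE; apply/eqP/xz/valP.
Qed.

End MarginalSums.

Lemma del_edge_sub (V : finType) (e : rel V) (i j : V) :
  subrel (del_edge e i j) e.
Proof. by move=> k l /andP[]. Qed.

Section RegionFactorization.
Variables (R : realType) (V X : finType) (e : rel V).
Variables (psie : V -> V -> X -> X -> R) (psiv : V -> X -> R) (psimax : R).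
Hypothesis e_sym : symmetric e.
Hypothesis (bounded : bounded_spec e psie psiv psimax).
Variables (U : {set V}) (N r : nat).
Hypotheses (treeN : tree_like e N) (treeU : bethe_region e U).
Hypotheses (diamU : eleq (diam e U) (Some (2 * r)%N)) (rN : (2 * r <= N)%N).

Local Notation sub := {i : V | i \in U}.
Local Notation B := (far_set e U N r).

Definition at_boundary : pred sub := [pred i | val i \in boundary e U].

Definition neighbor (i : V) : V := odflt i [pick u in nbhd e i :&: U].

Lemma neighborP (i : V) : i \in boundary e U ->
  [/\ e i (neighbor i), neighbor i \in U
    & forall k, k \in U -> e i k -> k = neighbor i].
Proof.
move=> iB; have [_ /(_ i iB)/eqP/cards1P[u uE]] := treeU.
have : u \in nbhd e i :&: U by rewrite uE inE.
rewrite !inE => /andP[iu uU].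
rewrite /neighbor uE; case: pickP => [v|/(_ u)]; rewrite !inE ?eqxx //.
move=> /eqP -> /=; split=> // k kU ik.
have : k \in nbhd e i :&: U by rewrite !inE ik.
by rewrite uE inE => /eqP.
Qed.

Lemma boundary_region i : i \in boundary e U -> i \in U.
Proof. by rewrite inE => /andP[]. Qed.

Definition inner_edge : pred (V * V) := [pred p | (p.1 \in U) && (p.2 \in U)].
Definition inner_site : pred V := [pred i | (i \in U) && (i \notin boundary e U)].

Definition outer_weight (x : {ffun V -> X}) : R :=
  edge_weight psie [pred p | oriented e p && ~~ inner_edge p] x
  * site_weight psiv (predC inner_site) x.

(** The weights of boundary vertices are left to [outer_weight]: on the
    boundary, messages stand in for them in the Bethe measure. *)
Definition region_weight (y : {ffun sub -> X}) : R :=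
  (\prod_(p : sub * sub | oriented (induced e U) p)
     psie (val p.1) (val p.2) (y p.1) (y p.2))
  * \prod_(i | ~~ at_boundary i) psiv (val i) (y i).

Lemma gibbs_weight_split x :
  gibbs_weight e psie psiv x = region_weight (restrict U x) * outer_weight x.
Proof.
rewrite gibbs_weightE /edge_weight (bigID inner_edge) /=.
rewrite /site_weight (bigID inner_site) /= mulrACA; congr (_ * _).
rewrite /region_weight; congr (_ * _); last first.
  rewrite big_sub_cond; apply: eq_bigr => i _; by rewrite ffunE.
pose F (k l : sub) := psie (val k) (val l) (restrict U x k) (restrict U x l).
have F_sym k l : induced e U k l -> F k l = F l k.
  by move=> kl; rewrite /F; case: bounded => _ _ h _; rewrite h.
have ind_sym : symmetric (induced e U) by move=> k l; rewrite /induced /= e_sym.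
rewrite -[RHS]/(\prod_(p : sub * sub | induced e U p.1 p.2 &&
   (enum_rank p.1 < enum_rank p.2)%N) F p.1 p.2).
rewrite (@orientation_indep _ _ (induced e U) F (fun k : sub => enum_rank k : nat)
   (fun k : sub => enum_rank (val k) : nat) ind_sym F_sym); first last.
- by move=> k l /ord_inj/enum_rank_inj/val_inj.
- by move=> k l /ord_inj/enum_rank_inj.
rewrite (prod_sub_pairs U (oriented e) (fun p => psie p.1 p.2 (x p.1) (x p.2))) /=.
by apply: eq_bigr => p _; rewrite /F !ffunE.
Qed.

Lemma outer_weight_exchange (i : V) x x' : i \in U ->
    restrict B x = restrict B x' ->
  outer_weight x * outer_weight x' =
  outer_weight (exchange (branch e U N r i) x x')
  * outer_weight (exchange (branch e U N r i) x' x).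
Proof.
move=> iU xB; rewrite /outer_weight mulrACA.
rewrite (edge_weight_exchange _ (C := branch e U N r i) xB); last first.
  move=> p /andP[/andP[ep _] np].
  apply: (branch_outer_edge e_sym treeN treeU diamU rN iU).
  by rewrite /outer /= ep.
by rewrite (site_weight_exchange _ _ (branch e U N r i)) mulrACA.
Qed.

Lemma outer_weight_update i a x : i \in U -> i \notin boundary e U ->
  outer_weight (update x i a) = outer_weight x.
Proof.
move=> iU iB; rewrite /outer_weight; congr (_ * _).
  apply: edge_weight_eq => -[k l] /= /andP[/andP[kl _]] nin.
  have nb_i j : e i j -> j \in U.
    by move: iB; rewrite inE iU /= negbK => /fintype.subsetP/(_ j); rewrite inE.
  rewrite !ffunE; split; case: eqP => // jE; subst; case/negP: nin.
    by rewrite /inner_edge /= iU nb_i.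
  by rewrite /inner_edge /= iU nb_i // e_sym.
apply: site_weight_eq => j /=; rewrite ffunE; case: eqP => // ->.
by rewrite /inner_site /= iU iB.
Qed.

Definition del_inner_weight (i : V) (x : {ffun V -> X}) : R :=
  edge_weight psie
    [pred p | oriented (del_edge e i (neighbor i)) p && inner_edge p] x
  * site_weight psiv inner_site x.

Lemma del_edge_split i x : i \in boundary e U ->
  gibbs_weight (del_edge e i (neighbor i)) psie psiv x
    = del_inner_weight i x * outer_weight x.
Proof.
move=> iB; have [_ nU _] := neighborP iB; have iU := boundary_region iB.
rewrite gibbs_weightE /edge_weight (bigID inner_edge) /=.
rewrite /site_weight (bigID inner_site) /= mulrACA; congr (_ * (_ * _)).
apply: eq_bigl => -[k l] /=; rewrite /oriented /inner_edge /=.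
rewrite -!andbA; congr (_ && _); case: (boolP (_ && (l \in U))) => nin /=.
  by rewrite !andbF.
suff -> : [set k; l] != [set i; neighbor i] by [].
apply: contra nin => /eqP klE.
have: k \in [set i; neighbor i] by rewrite -klE !inE eqxx.
have: l \in [set i; neighbor i] by rewrite -klE !inE eqxx orbT.
by rewrite !inE => /orP[]/eqP -> /orP[]/eqP ->; rewrite ?iU ?nU.
Qed.

Lemma branch_in_region i j : i \in U -> j \in U ->
  (j \in branch e U N r i) = (j == i).
Proof.
move=> iU jU; apply/idP/eqP => [ji|->]; last exact: branch_self.
by apply/esym/(branch_region e_sym treeN treeU diamU rN iU jU).
Qed.

Lemma del_inner_weight_exchange i x x' : i \in boundary e U ->
  del_inner_weight i (exchange (branch e U N r i) x x') = del_inner_weight i x.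
Proof.
move=> iB; have [_ nU nE] := neighborP iB; have iU := boundary_region iB.
rewrite /del_inner_weight; congr (_ * _).
  apply: edge_weight_eq => -[k l] /= /andP[/andP[/andP[kl nkl] _] /andP[kU lU]].
  rewrite !ffunE !branch_in_region //=; split; case: eqP => // jE; case/negP: nkl.
    by rewrite jE (nE l lU) -?jE.
  by rewrite jE (nE k kU) 1?finset.setUC // e_sym -jE.
apply: site_weight_eq => j /andP[jU jB]; rewrite ffunE branch_in_region //.
by case: eqP => // jE; rewrite jE iB in jB.
Qed.

(** The edges inside the region that survive the deletion do not meet the
    branch of [i], since the deleted edge is the only one joining [i] to the
    region. *)
Lemma del_edge_exchange i x x' : i \in boundary e U ->
    restrict B x = restrict B x' ->
  gibbs_weight (del_edge e i (neighbor i)) psie psiv x * outer_weight x'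
  = gibbs_weight (del_edge e i (neighbor i)) psie psiv
      (exchange (branch e U N r i) x x')
    * outer_weight (exchange (branch e U N r i) x' x).
Proof.
move=> iB xB; have iU := boundary_region iB.
rewrite !del_edge_split // -[LHS]mulrA -[RHS]mulrA (outer_weight_exchange iU xB).
by rewrite del_inner_weight_exchange.
Qed.

Local Notation Z := (partition_fun e psie psiv).

Definition outer_sum (b : {ffun {i | i \in B} -> X}) (y : {ffun sub -> X}) : R :=
  \sum_(x | (restrict U x == y) && (restrict B x == b)) outer_weight x / Z.

Definition cavity_sum (i : sub) (b : {ffun {i | i \in B} -> X}) (a : X) : R :=
  \sum_(x : {ffun V -> X} | (x (val i) == a) && (restrict B x == b))
     gibbs (del_edge e (val i) (neighbor (val i))) psie psiv x.

Lemma joint_marginalE y b :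
  joint_marginal (gibbs e psie psiv) U B (y, b) = region_weight y * outer_sum b y.
Proof.
rewrite /joint_marginal /outer_sum mulr_sumr; apply: eq_bigr => x /= /andP[/eqP <- _].
by rewrite /gibbs gibbs_weight_split mulrA.
Qed.

Lemma restrict_branch (i : sub) (x x' : {ffun V -> X}) :
  restrict U (exchange (branch e U N r (val i)) x x')
    = update (restrict U x) i (x' (val i)).
Proof.
by apply: restrict_exchange_one => j jU; rewrite branch_in_region //; exact: valP.
Qed.

(** Independence of the branches given the configuration on the far set: the
    exchange on the branch of [i] changes the region at [i] only. *)
Lemma outer_sum_swap b y z (i : sub) :
  outer_sum b y * outer_sum b z
    = outer_sum b (update y i (z i)) * outer_sum b (update z i (y i)).
Proof.
have iU := valP i.
apply: (exchange_sums (C := branch e U N r (val i))) => x x'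
    /andP[/eqP xU /eqP xB] /andP[/eqP xU' /eqP xB'].
  have xx' : restrict B x = restrict B x' by rewrite xB.
  rewrite !restrict_branch !restrict_exchange_agree // xU xU' xB xB' !eqxx !andbT.
  split; try by [rewrite -xU' ffunE | rewrite -xU ffunE].
  by rewrite mulrACA [RHS]mulrACA -outer_weight_exchange.
have xx' : restrict B x = restrict B x' by rewrite xB.
have xi : x (val i) = z i.
  by rewrite -[LHS](ffunE (fun i : sub => x (val i))) -/(restrict U x) xU update_at.
have xi' : x' (val i) = y i.
  by rewrite -[LHS](ffunE (fun i : sub => x' (val i))) -/(restrict U x') xU' update_at.
rewrite !restrict_branch !restrict_exchange_agree // xU xU' xB xB' !eqxx !andbT.
by rewrite !update_update xi xi' !update_id !eqxx.
Qed.

Lemma outer_sum_update b y (i : sub) a :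
  ~~ at_boundary i -> outer_sum b (update y i a) = outer_sum b y.
Proof.
move=> iB; have iU := valP i.
have iF : val i \notin B by exact: region_far.
have resB c x : restrict B (update x (val i) c) = restrict B x.
  apply/ffunP => j; rewrite !ffunE; case: eqP => // jE.
  by case/negP: iF; rewrite -jE; exact: valP.
have resU c x : restrict U (update x (val i) c) = update (restrict U x) i c.
  apply/ffunP => j; rewrite !ffunE; case: (j =P i) => [->|ji]; first by rewrite eqxx.
  by case: eqP => // /val_inj.
rewrite /outer_sum (reindex_onto (fun x => update x (val i) a)
  (fun x => update x (val i) (y i))) /=; last first.
  move=> x /andP[/eqP xU _]; rewrite update_update.
  have <- : x (val i) = a.
    by rewrite -[LHS](ffunE (fun i : sub => x (val i))) -/(restrict U x) xU update_at.
  exact: update_id.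
apply: eq_big => [x|x _]; last by rewrite outer_weight_update.
rewrite resB resU andbAC; congr (_ && _); apply/andP/eqP => [[/eqP yE /eqP xE]|xU].
  have xi : x (val i) = y i.
    by rewrite -[in LHS]xE update_update update_at.
  rewrite -(update_id (restrict U x) i) ffunE xi.
  by rewrite -(update_update (restrict U x) i a) yE update_update update_id.
rewrite xU eqxx update_update; split=> //.
have <- : x (val i) = y i by rewrite -xU ffunE.
by rewrite update_id.
Qed.

Lemma cavity_sum_swap (i : sub) b a z : at_boundary i ->
  cavity_sum i b a * outer_sum b z
    = cavity_sum i b (z i) * outer_sum b (update z i a).
Proof.
move=> iB; have iU := valP i.
have self x x' : exchange (branch e U N r (val i)) x x' (val i) = x' (val i).
  by rewrite ffunE branch_self.
apply: (exchange_sums (C := branch e U N r (val i))) => x x'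
    /andP[/eqP xi /eqP xB] /andP[/eqP xU' /eqP xB'].
  have xx' : restrict B x = restrict B x' by rewrite xB.
  rewrite self restrict_branch !restrict_exchange_agree // xU' xB xB' xi !eqxx !andbT.
  split=> //; first by rewrite -xU' ffunE.
  by rewrite /gibbs mulrACA [RHS]mulrACA -del_edge_exchange.
have xx' : restrict B x = restrict B x' by rewrite xB.
have xi' : x' (val i) = a.
  by rewrite -[LHS](ffunE (fun i : sub => x' (val i))) -/(restrict U x') xU' update_at.
rewrite self restrict_branch !restrict_exchange_agree // xU' xB xB' xi xi'.
by rewrite !eqxx update_update update_id eqxx.
Qed.

Lemma cavity_sum_marginal (i : sub) a :
  \sum_b cavity_sum i b a
    = standard_messages e psie psiv (val i) (neighbor (val i)) a.
Proof.
rewrite /standard_messages (partition_big (fun x => restrict B x) xpredT) //=.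
Qed.

Lemma cavity_sum_total (i : sub) b :
  \sum_a cavity_sum i b a
    = \sum_(x | restrict B x == b)
        gibbs (del_edge e (val i) (neighbor (val i))) psie psiv x.
Proof.
rewrite [RHS](partition_big (fun x : {ffun V -> X} => x (val i)) xpredT) //=.
by apply: eq_bigr => a _; apply: eq_bigl => x; rewrite andbC.
Qed.

Lemma bethe_weightE y :
  gibbs_weight (induced e U) (fun i j => psie (val i) (val j))
    (fun i => psi_star e psiv (standard_messages e psie psiv) U (val i)) y
  = region_weight y * \prod_(i | at_boundary i) \sum_b cavity_sum i b (y i).
Proof.
rewrite /gibbs_weight -[RHS]mulrA; congr (_ * _).
rewrite (bigID at_boundary) /= mulrC; congr (_ * _).
  by apply: eq_bigr => i iB; rewrite /psi_star (ifN _ _ iB).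
apply: eq_bigr => i iB; rewrite cavity_sum_marginal /psi_star (ifT _ _ iB).
have [_ /(_ _ iB)/eqP/cards1P[u uE]] := treeU.
rewrite /neighbor uE; case: pickP => //= /(_ u); by rewrite inE eqxx.
Qed.

End RegionFactorization.

(** * The estimate for one region *)
Section RegionEstimate.
Variables (R : realType) (V X : finType) (e : rel V).
Variables (psie : V -> V -> X -> X -> R) (psiv : V -> X -> R) (psimax kappa : R).
Hypotheses (e_sym : symmetric e) (e_irr : irreflexive e).
Hypothesis (bounded : bounded_spec e psie psiv psimax).
Hypotheses (kappa_gt0 : 0 < kappa) (kappa_le1 : kappa <= 1).
Hypothesis (psiv_ge : forall i a, kappa * psimax <= psiv i a).
Variable xp : V -> X.
Hypothesis (psie_ge : forall i j, e i j -> forall a,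
  kappa * psimax <= psie i j (xp i) a /\ kappa * psimax <= psie i j a (xp j)).
Hypothesis (X_gt0 : (0 < #|X|)%N).
Variables (U : {set V}) (N r : nat).
Hypotheses (treeN : tree_like e N) (treeU : bethe_region e U).
Hypotheses (diamU : eleq (diam e U) (Some (2 * r)%N)) (rN : (2 * r <= N)%N).

Local Notation sub := {i : V | i \in U}.
Local Notation B := (far_set e U N r).
Local Notation mu := (gibbs e psie psiv).
Local Notation Z := (partition_fun e psie psiv).
Local Notation bd := (@at_boundary V e U).
Local Notation H := (@cavity_sum R V X e psie psiv U N r).
Local Notation Phi := (@region_weight R V X e psie psiv U).
Local Notation Gs := (@outer_sum R V X e psie psiv U N r).
Local Notation beta := (permit_prob X e kappa).

Let z : {ffun V -> X} := [ffun v => xp v].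
Let t : {ffun sub -> X} := restrict U z.
Let n := #|U|.
Let M := psimax ^+ #|[pred p : sub * sub | oriented (induced e U) p]|
       * psimax ^+ #|[pred i : sub | ~~ bd i]|.

Lemma permit_prob_gt0 : 0 < beta.
Proof. by rewrite divr_gt0 ?ltr0n // exprn_gt0. Qed.

Lemma region_pair_edge (p : sub * sub) :
  oriented (induced e U) p -> e (val p.1) (val p.2).
Proof. by case/andP. Qed.

Lemma region_weight_ge0 y : 0 <= Phi y.
Proof.
rewrite mulr_ge0 // prodr_ge0 // => [p /region_pair_edge ep|i _].
  by case/andP: (psie_bounds bounded (y p.1) (y p.2) ep).
by apply: ltW; exact: (psiv_gt0 bounded kappa_gt0 psiv_ge).
Qed.

Lemma region_weight_le y : Phi y <= M.
Proof.
rewrite /region_weight /M -!prodr_const; apply: ler_pM.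
- apply: prodr_ge0 => p /region_pair_edge ep.
  by case/andP: (psie_bounds bounded (y p.1) (y p.2) ep).
- by apply: prodr_ge0 => i _; apply: ltW; exact: (psiv_gt0 bounded kappa_gt0 psiv_ge).
- apply: ler_prod => p /region_pair_edge ep.
  exact: (psie_bounds bounded).
- apply: ler_prod => i _; exact: (psiv_bounds bounded).
Qed.

(** The exponent bounds the number of pairs of vertices of the region plus the
    number of its vertices. *)
Lemma region_weight_ge (y : {ffun sub -> X}) :
    (forall k l, induced e U k l -> y k = xp (val k) \/ y l = xp (val l)) ->
  kappa ^+ (n * n + n) * M <= Phi y.
Proof.
have psi0 := psimax_gt0 bounded.
have k0 := ltW kappa_gt0.
move=> yxp; rewrite exprD /M mulrACA.
have cs : #|{: sub}| = n by rewrite card_sig.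
apply: ler_pM; rewrite ?mulr_ge0 ?exprn_ge0 ?(ltW psi0) //.
  set m := #|_|; apply: (@le_trans _ _ ((kappa * psimax) ^+ m)).
    rewrite exprMn ler_wpM2r ?exprn_ge0 ?(ltW psi0) //.
    apply: ler_wiXn2l => //; apply: leq_trans (max_card _) _.
    by rewrite card_prod cs.
  rewrite -prodr_const; apply: ler_prod => p pp; rewrite mulr_ge0 ?(ltW psi0) //=.
  have ep := region_pair_edge pp.
  case: (yxp p.1 p.2 ep) => ->; first by case: (psie_ge ep (y p.2)).
  by case: (psie_ge ep (y p.1)).
set m := #|_|; apply: (@le_trans _ _ ((kappa * psimax) ^+ m)).
  rewrite exprMn ler_wpM2r ?exprn_ge0 ?(ltW psi0) //.
  apply: ler_wiXn2l => //; apply: leq_trans (max_card _) _.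
  by rewrite cs.
by rewrite -prodr_const; apply: ler_prod => i _; rewrite mulr_ge0 ?(ltW psi0) //=.
Qed.

Lemma far_disjoint i : i \in B -> i \notin U.
Proof. by apply: contraL; exact: region_far. Qed.

Lemma permitted_joint b :
  beta ^+ n * marginal mu B b <= joint_marginal mu U B (t, b).
Proof.
rewrite /marginal /joint_marginal /gibbs -!mulr_suml mulrA.
have Z0 := partition_gt0 bounded kappa_gt0 psiv_ge psie_ge (fun k l => id) : 0 < Z.
rewrite ler_pM2r ?invr_gt0 //=.
have Qex x : restrict B x == b -> restrict B (exchange U x z) == b.
  by rewrite restrict_exchange_disjoint //; exact: far_disjoint.
have := permitted_sum e_sym bounded kappa_gt0 kappa_le1 psiv_ge psie_ge
  (e0 := e) (Q := fun x => restrict B x == b) (fun k l => id)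
  (@shielded_permitted V X e xp U) X_gt0 Qex.
move/le_trans; apply.
rewrite le_eqVlt; apply/orP; left; apply/eqP/eq_bigl => x.
by rewrite andbC /t restrict_eqE.
Qed.

Section CavityBounds.
Variable i : sub.
Hypothesis iB : bd i.

Let u := neighbor e U (val i).
Let e' := del_edge e (val i) u.
Let Z' := partition_fun e' psie psiv.

Let iu : e (val i) u.
Proof. by case: (neighborP treeU iB). Qed.

Let e'_sub : subrel e' e := @del_edge_sub _ _ _ _.

Let Z'_gt0 : 0 < Z'.
Proof. exact: (partition_gt0 bounded kappa_gt0 psiv_ge psie_ge e'_sub). Qed.

Let Z_gt0 : 0 < Z.
Proof. exact: (partition_gt0 bounded kappa_gt0 psiv_ge psie_ge (fun k l => id)). Qed.

Let w'_ge0 x : 0 <= gibbs_weight e' psie psiv x.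
Proof. exact: (gibbs_weight_ge0 bounded kappa_gt0 psiv_ge x e'_sub). Qed.

Let split x : gibbs_weight e psie psiv x
   = gibbs_weight e' psie psiv x * psie (val i) u (x (val i)) (x u).
Proof.
by apply: del_edge_weight => // k l kl a b; exact: (psie_sym bounded).
Qed.

Let weight_le x :
  gibbs_weight e psie psiv x <= psimax * gibbs_weight e' psie psiv x.
Proof.
rewrite split mulrC ler_wpM2r //.
by case/andP: (psie_bounds bounded (x (val i)) (x u) iu).
Qed.

Lemma cavity_ge0 b a : 0 <= H i b a.
Proof. by apply: sumr_ge0 => x _; rewrite divr_ge0 // ltW. Qed.

Lemma cavity_sum1 : \sum_b \sum_a H i b a = 1.
Proof.
under eq_bigr do rewrite cavity_sum_total.
have [_ <-] := gibbs_distr bounded kappa_gt0 psiv_ge psie_ge e'_sub.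
by rewrite [RHS](partition_big (fun x => restrict B x) xpredT).
Qed.

Let cavity_permitted_weight b :
  beta * \sum_(x | restrict B x == b) gibbs_weight e' psie psiv x
  <= \sum_(x : {ffun V -> X} | (x (val i) == t i) && (restrict B x == b))
       gibbs_weight e' psie psiv x.
Proof.
have Qex x : restrict B x == b -> restrict B (exchange [set val i] x z) == b.
  rewrite restrict_exchange_disjoint // => j jB; rewrite inE; apply: contraTneq jB => ->.
  exact/region_far/valP.
have := permitted_sum e_sym bounded kappa_gt0 kappa_le1 psiv_ge psie_ge
  (Q := fun x => restrict B x == b) e'_sub
  (@shielded_permitted V X e xp [set val i]) X_gt0 Qex.
rewrite cards1 expr1 => /le_trans; apply; rewrite le_eqVlt; apply/orP; left.
apply/eqP/eq_bigl => x; rewrite andbC; congr (_ && _).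
rewrite [t i]ffunE.
apply/forall_inP/eqP => [h|xi j]; first by apply/eqP/h; rewrite inE.
by rewrite inE => /eqP ->; apply/eqP.
Qed.

Lemma cavity_permitted b : beta * (\sum_a H i b a) <= H i b (t i).
Proof.
rewrite cavity_sum_total /cavity_sum /gibbs -!mulr_suml mulrA.
by rewrite ler_pM2r ?invr_gt0 //; exact: cavity_permitted_weight.
Qed.

(** Overwriting [val i] by its permitted state costs a factor [beta]; once it is
    permitted, putting the deleted edge back costs a further [kappa]. *)
Lemma cavity_le b : \sum_a H i b a <= (beta * kappa)^-1 * marginal mu B b.
Proof.
have psi0 := psimax_gt0 bounded; have b0 := permit_prob_gt0.
rewrite cavity_sum_total /marginal /gibbs -!mulr_suml.
set S' := \sum_(_ | _) _; set S := \sum_(_ | _) _.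
have S'0 : 0 <= S' by apply: sumr_ge0.
have SS : beta * kappa * psimax * S' <= S.
  rewrite (_ : _ * S' = beta * S' * (kappa * psimax)); last by ring.
  apply: (@le_trans _ _ (\sum_(x : {ffun V -> X} | (x (val i) == t i) &&
     (restrict B x == b)) gibbs_weight e' psie psiv x * (kappa * psimax))).
    by rewrite -mulr_suml ler_wpM2r ?cavity_permitted_weight // mulr_ge0 // ltW.
  rewrite [leRHS](bigID (fun x : {ffun V -> X} => x (val i) == t i)) /=.
  rewrite ler_wpDr //; first by apply: sumr_ge0 => x _; rewrite split mulr_ge0 //;
    case/andP: (psie_bounds bounded (x (val i)) (x u) iu).
  rewrite [leRHS](eq_bigl (fun x : {ffun V -> X} => (x (val i) == t i) &&
     (restrict B x == b))) => [|x]; last by rewrite andbC.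
  apply: ler_sum => x /andP[/eqP xi _]; rewrite split ler_wpM2l //.
  by rewrite xi !ffunE; case: (psie_ge iu (x u)).
have ZZ : Z <= psimax * Z' by rewrite /Z' mulr_sumr; apply: ler_sum.
rewrite ler_pdivrMr //.
rewrite (_ : _ * Z' = S * Z' / (beta * kappa * Z)); last first.
  by field; rewrite !gt_eqF.
have bk0 : 0 < beta * kappa by exact: mulr_gt0.
rewrite ler_pdivlMr; last exact: mulr_gt0.
rewrite (_ : S' * _ = beta * kappa * S' * Z); last by ring.
apply: (@le_trans _ _ (beta * kappa * S' * (psimax * Z'))).
  by rewrite ler_wpM2l // (mulr_ge0 (ltW bk0)).
rewrite (_ : _ * (psimax * Z') = beta * kappa * psimax * S' * Z'); last by ring.
by rewrite ler_wpM2r // ltW.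
Qed.

Lemma cavity_gt0 b : 0 < marginal mu B b -> 0 < \sum_a H i b a.
Proof.
have psi0 := psimax_gt0 bounded.
rewrite cavity_sum_total /marginal /gibbs -!mulr_suml.
rewrite !pmulr_lgt0 ?invr_gt0 // => S0.
rewrite -(pmulr_rgt0 _ psi0) mulr_sumr; apply: lt_le_trans S0 _.
exact: ler_sum.
Qed.

End CavityBounds.

Lemma region_estimate (d : R) :
    tv (joint_marginal mu U B) (fun y => marginal mu U y.1 * marginal mu B y.2) <= d ->
  tv (marginal mu U) (bethe_measure e psie psiv (standard_messages e psie psiv) U)
  <= d * (1 + #|[pred i | bd i]|%:R *
       (4 * #|X|%:R ^+ n.+1 * (1 + (beta * kappa)^-1)
         / ((kappa ^+ (n * n + n)) ^+ 2 * beta ^+ n * beta ^+ #|[pred i | bd i]|))).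
Proof.
move=> decor.
have psi0 := psimax_gt0 bounded; have beta0 := permit_prob_gt0.
have M0 : 0 < M by rewrite mulr_gt0 // exprn_gt0.
have JE y b : Phi y * Gs b y
    = joint_marginal mu U B (y, b).
  by rewrite (joint_marginalE e_sym bounded).
have PBE b : \sum_y Phi y * Gs b y
    = marginal mu B b.
  by under eq_bigr do rewrite JE; rewrite joint_marginal_suml.
have PUE y : \sum_b Phi y * Gs b y
    = marginal mu U y.
  by under eq_bigr do rewrite JE; rewrite joint_marginal_sumr.
have dis := gibbs_distr bounded kappa_gt0 psiv_ge psie_ge (fun k l => id) :
  is_distr (gibbs e psie psiv).
have cs : #|{: sub}| = n by rewrite card_sig.
have := @bethe_estimate R sub X {ffun {i | i \in B} -> X} bd
  Phi Gs H t M (kappa ^+ (n * n + n))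
  beta (beta ^+ n) (beta * kappa)^-1 (2 * d) M0.
have Z0 := partition_gt0 bounded kappa_gt0 psiv_ge psie_ge (fun k l => id) : 0 < Z.
rewrite cs => est; rewrite /tv.
rewrite (eq_bigr (fun y => `|(\sum_b Phi y *
    Gs b y) -
    (Phi y * \prod_(i | bd i) \sum_b H i b (y i)) /
    \sum_y (Phi y * \prod_(i | bd i) \sum_b H i b (y i))|));
  last first.
  move=> y _; rewrite PUE /bethe_measure /gibbs /partition_fun.
  rewrite (bethe_weightE psie psiv N r treeU) (eq_bigr _
    (fun y _ => bethe_weightE psie psiv N r treeU y)) //.
rewrite mulrC ler_pdivrMr // [leRHS]mulrC [leRHS]mulrA.
apply: est.
- exact: exprn_gt0.
- exact: beta0.
- exact: exprn_gt0.
- by rewrite invr_ge0 mulr_ge0 // ltW.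
- exact: region_weight_ge0.
- exact: region_weight_le.
- by apply: region_weight_ge => k l _; left; rewrite !ffunE.
- move=> i a; apply: region_weight_ge => k l kl.
  have kl_neq : k != l by apply: contraTneq kl => ->; rewrite /induced /= e_irr.
  rewrite !ffunE; case: (k =P i) => [ki|_]; last by left.
  by right; rewrite ifN // -ki eq_sym.
- move=> b y; apply: sumr_ge0 => x _; rewrite divr_ge0 ?(ltW Z0) //.
  rewrite mulr_ge0 // prodr_ge0 // => [p /andP[/andP[ep _] _]|j _].
    by case/andP: (psie_bounds bounded (x p.1) (x p.2) ep).
  by apply: ltW; exact: (psiv_gt0 bounded kappa_gt0 psiv_ge).
- move=> b y y' i; exact: (outer_sum_swap psie psiv e_sym treeN treeU diamU rN).
- by move=> b y i a iB; exact: (outer_sum_update psie psiv e_sym).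
- by under eq_bigr do rewrite PBE; rewrite marginal_sum; case: dis.
- by move=> b; rewrite PBE JE; exact: permitted_joint.
- by move=> i b a iB; exact: cavity_ge0.
- by move=> i iB; exact: cavity_sum1.
- by move=> i b a y iB; exact: (cavity_sum_swap psie psiv e_sym treeN treeU diamU rN).
- by move=> i b iB; exact: cavity_permitted.
- by move=> i b iB; rewrite PBE; exact: cavity_le.
- by move=> i b iB; rewrite PBE; exact: cavity_gt0.
- rewrite -ler_pdivrMl //; apply: le_trans decor; rewrite /tv ler_wpM2l ?invr_ge0 //.
  rewrite exchange_big pair_bigA /=; apply: ler_sum => -[y b] _ /=.
  by rewrite JE PUE PBE.
Qed.

End RegionEstimate.

(** * Measures with a positive normalisation *)
Section TotalVariation.
Variables (R : realType) (T : finType) (p q : T -> R).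
Hypotheses (p_distr : is_distr p) (q_distr : is_distr q).

Lemma tv_le1 : tv p q <= 1.
Proof.
case: p_distr q_distr => p0 p1 [q0 q1]; rewrite /tv ler_pdivrMl // mulr1.
apply: (@le_trans _ _ (\sum_x (p x + q x))); last by rewrite big_split /= p1 q1.
apply: ler_sum => x _; apply: le_trans (ler_normB _ _) _.
by rewrite !ger0_norm.
Qed.

Lemma tv_subsingleton : (#|T| <= 1)%N -> tv p q = 0.
Proof.
move=> T1; rewrite /tv big1 ?mulr0 // => x _.
have all_x y : y = x by have /fintype_le1P/(_ y x) := T1.
have sumE (f : T -> R) : \sum_y f y = f x.
  by rewrite (bigD1 x) //= big1 ?addr0 // => y; rewrite (all_x y) eqxx.
case: p_distr q_distr => _ p1 [_ q1].
by rewrite -(sumE p) -(sumE q) p1 q1 subrr normr0.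
Qed.

End TotalVariation.

Section PositiveMeasures.
Variables (R : realType) (V X : finType) (e : rel V).
Variables (psie : V -> V -> X -> X -> R) (psiv : V -> X -> R) (psimax kappa : R).
Hypotheses (e_sym : symmetric e) (e_irr : irreflexive e).
Hypothesis (bounded : bounded_spec e psie psiv psimax).
Hypotheses (kappa_gt0 : 0 < kappa) (kappa_le1 : kappa <= 1).
Hypothesis (psiv_ge : forall i a, kappa * psimax <= psiv i a).
Variable xp : V -> X.
Hypothesis (psie_ge : forall i j, e i j -> forall a,
  kappa * psimax <= psie i j (xp i) a /\ kappa * psimax <= psie i j a (xp j)).

Local Notation mu := (gibbs e psie psiv).
Local Notation std := (standard_messages e psie psiv).
Local Notation beta := (permit_prob X e kappa).

Lemma standard_messages_distr i j : is_distr (std i j).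
Proof.
have [g0 g1] := gibbs_distr bounded kappa_gt0 psiv_ge psie_ge (@del_edge_sub V e i j).
split=> [a|]; first by apply: sumr_ge0 => x _; exact: g0.
by rewrite -g1 [RHS](partition_big (fun x : {ffun V -> X} => x i) xpredT).
Qed.

Lemma standard_messages_gt0 i j : 0 < std i j (xp i).
Proof.
have sub := @del_edge_sub V e i j.
have [g0 _] := gibbs_distr bounded kappa_gt0 psiv_ge psie_ge sub.
rewrite /standard_messages (bigD1 [ffun v => xp v]) /=; last by rewrite ffunE.
apply: ltr_wpDr; first by apply: sumr_ge0 => x _; exact: g0.
rewrite divr_gt0 ?(partition_gt0 bounded kappa_gt0 psiv_ge psie_ge sub) //.
exact: (permitted_weight_gt0 bounded kappa_gt0 psiv_ge psie_ge sub).
Qed.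

Lemma marginal_distr (U : {set V}) : is_distr (marginal mu U).
Proof.
have [g0 g1] := gibbs_distr bounded kappa_gt0 psiv_ge psie_ge (fun k l => id) :
  is_distr mu.
split=> [y|]; first by apply: sumr_ge0 => x _; exact: g0.
by rewrite marginal_sum.
Qed.

Lemma bethe_distr (U : {set V}) : is_distr (bethe_measure e psie psiv std U).
Proof.
set w := gibbs_weight (induced e U) (fun i j => psie (val i) (val j))
    (fun i => psi_star e psiv std U (val i)).
have star0 i a : 0 <= psi_star e psiv std U i a.
  rewrite /psi_star; case: ifP => _; last exact/ltW/(psiv_gt0 bounded kappa_gt0 psiv_ge).
  case: pickP => [u _|_]; last exact/ltW/(psiv_gt0 bounded kappa_gt0 psiv_ge).
  by case: (standard_messages_distr i u).
have star_gt0 i : 0 < psi_star e psiv std U i (xp i).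
  rewrite /psi_star; case: ifP => _; last exact: (psiv_gt0 bounded kappa_gt0 psiv_ge).
  case: pickP => [u _|_]; last exact: (psiv_gt0 bounded kappa_gt0 psiv_ge).
  exact: standard_messages_gt0.
have w0 y : 0 <= w y.
  rewrite mulr_ge0 // prodr_ge0 // => p /andP[ep _].
  by case/andP: (psie_bounds bounded (y p.1) (y p.2) ep).
have S0 : 0 < \sum_y w y.
  rewrite (bigD1 [ffun i => xp (val i)]) //=; apply: ltr_wpDr.
    exact: sumr_ge0.
  rewrite mulr_gt0 // prodr_gt0 // => [p /andP[ep _]|i _]; last by rewrite ffunE.
  rewrite !ffunE; case: (psie_ge ep (xp (val p.2))) => h _.
  by apply: lt_le_trans h; rewrite mulr_gt0 // (psimax_gt0 bounded).
split=> [y|]; first by rewrite divr_ge0 // ltW.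
by rewrite -mulr_suml divff // gt_eqF.
Qed.

Hypothesis X_gt0 : (0 < #|X|)%N.

Lemma permit_prob_le1 : beta <= 1.
Proof.
rewrite ler_pdivrMr ?ltr0n // mul1r; apply: (@le_trans _ _ 1); last by rewrite ler1n.
by rewrite exprn_ile1 // ltW.
Qed.

(** Overwrite the neighbours of [v] by permitted states: then any state is
    allowed at [v] itself. *)
Lemma site_marginal_ge (v : V) (a : X) :
  beta ^+ (max_degree e).+1 <=
  marginal mu [set v] (restrict [set v] [ffun=> a]).
Proof.
have beta_gt0 := permit_prob_gt0 e kappa_gt0 X_gt0.
have id_sub : subrel e e by [].
have Z0 := partition_gt0 bounded kappa_gt0 psiv_ge psie_ge id_sub.
pose A := v |: nbhd e v; pose z : {ffun V -> X} := update [ffun i => xp i] v a.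
have sh : shielded e xp A z.
  move=> k l kl kA; rewrite !ffunE; case: (k =P v) => [kv|_]; last by left.
  right; split; first by rewrite !inE -kv kl orbT.
  by case: (l =P v) => // lv; rewrite kv lv e_irr in kl.
have := permitted_sum e_sym bounded kappa_gt0 kappa_le1 psiv_ge psie_ge
  (Q := xpredT) id_sub sh X_gt0 (fun _ => id).
rewrite -/(partition_fun e psie psiv) => sumA.
have cA : (#|A| <= (max_degree e).+1)%N.
  rewrite cardsU1 -[(_).+1]add1n leq_add ?leq_b1 //.
  exact: (leq_bigmax (F := fun k => #|nbhd e k|)).
apply: (@le_trans _ _ (beta ^+ #|A|)).
  by apply: ler_wiXn2l cA; [exact: ltW | exact: permit_prob_le1].
rewrite /marginal /gibbs -mulr_suml ler_pdivlMr //; apply: (le_trans sumA).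
rewrite [leRHS](bigID (fun x : {ffun V -> X} => [forall i in A, x i == z i])) /=.
rewrite ler_wpDr //; first by apply: sumr_ge0 => x _;
  exact: (gibbs_weight_ge0 bounded kappa_gt0 psiv_ge).
rewrite le_eqVlt; apply/orP; left; apply/eqP/eq_bigl => x.
rewrite restrict_eqE andb_idl // => /forall_inP xA; apply/forall_inP => i.
by rewrite inE => /eqP ->; rewrite (eqP (xA v _)) ?setU11 // !ffunE eqxx.
Qed.

(** Two different states at one vertex never occur together, although each has
    probability bounded below; so a vertex is far from being independent of
    itself, and extremality at distance 0 bounds [delta 0] below. *)
Lemma extremal_rate0 (delta : nat -> R) (v : V) :
    extremal e delta mu -> (forall n, 0 <= delta n) ->
    (forall n, delta n <= delta 0%N) -> (1 < #|X|)%N ->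
  2^-1 * (beta ^+ (max_degree e).+1) ^+ 2 <= delta 0%N.
Proof.
move=> ext d0 dle X2; have beta_gt0 := permit_prob_gt0 e kappa_gt0 X_gt0.
have [a [a' aa']] : exists a a' : X, a != a'.
  by move: X2 => /card_gt1P[a [a' [_ _ ?]]]; exists a, a'.
pose y c : {ffun {i | i \in [set v]} -> X} := restrict [set v] [ffun=> c].
apply: (@le_trans _ _ (rate_at delta (set_dist e [set v] [set v]))); last first.
  by rewrite /rate_at; case: set_dist.
apply: le_trans (ext [set v] [set v]); rewrite /tv ler_wpM2l ?invr_ge0 //.
rewrite (bigD1 (y a, y a')) //=; apply: ler_wpDr; first exact: sumr_ge0.
rewrite /joint_marginal big1 => [|x /= /andP[]]; last first.
  rewrite !restrict_eqE => /forall_inP/(_ v (set11 v))/eqP xa.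
  move=> /forall_inP/(_ v (set11 v))/eqP xa'.
  by case/eqP: aa'; rewrite !ffunE in xa xa'; rewrite -xa -xa'.
rewrite sub0r normrN expr2; apply: le_trans (ler_norm _).
have b0 : 0 <= beta ^+ (max_degree e).+1 by rewrite exprn_ge0 // ltW.
by apply: ler_pM => //; exact: site_marginal_ge.
Qed.

End PositiveMeasures.

(** * Absorbing the constants *)
Section Constants.
Variable R : realType.

(** The base is absorbed by [A <= expR A] and the exponent by
    [A * b ^ r <= (A * b) ^ r]. *)
Lemma power_le_exp (A c : R) (b k r : nat) :
    1 <= A -> (0 < r)%N -> (k <= b ^ r)%N -> A * b%:R <= c ->
  A ^+ k <= expR (c ^+ r).
Proof.
move=> A1 r0 kb Ac; have A0 : 0 <= A by apply: le_trans A1.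
apply: (@le_trans _ _ (expR A ^+ k)).
  rewrite lerXn2r ?nnegrE ?expR_ge0 //.
  by apply: le_trans (expR_ge1Dx A); rewrite lerDr.
rewrite -expRM_natl ler_expR; apply: (@le_trans _ _ (A ^+ r * b%:R ^+ r)).
  rewrite mulrC -natrX; apply: ler_pM => //; last by rewrite ler_nat.
  by case: r r0 {kb} => // r _; rewrite exprS ler_peMr // exprn_ege1.
rewrite -exprMn lerXn2r ?nnegrE ?mulr_ge0 //.
by apply: le_trans Ac; rewrite mulr_ge0.
Qed.

Lemma error_factor_le (q n m : nat) (kappa beta : R) :
    (0 < q)%N -> (0 < n)%N -> (m <= n)%N ->
    0 < kappa <= 1 -> 0 < beta <= 1 ->
  1 + m%:R * (4 * q%:R ^+ n.+1 * (1 + (beta * kappa)^-1)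
       / ((kappa ^+ (n * n + n)) ^+ 2 * beta ^+ n * beta ^+ m))
  <= (18 * q%:R ^+ 2 / (kappa ^+ 5 * beta ^+ 3)) ^+ (n * n).
Proof.
move=> q0 n0 mn /andP[k0 k1] /andP[b0 b1].
have ns : (n <= n * n)%N by rewrite leq_pmull.
have s0 : (0 < n * n)%N by rewrite muln_gt0 n0.
move: (n * n)%N ns s0 => s ns s0.
have [exp_q exp_k exp_b] : [/\ n.+1 <= 2 * s, (2 * s + 2 * n).+1 <= 5 * s
    & (n + m).+1 <= 3 * s]%N by split; lia.
set k := kappa^-1; set b := beta^-1.
have kge1 : 1 <= k by rewrite invf_ge1.
have bge1 : 1 <= b by rewrite invf_ge1.
have qge1 : 1 <= q%:R :> R by rewrite ler1n.
have [k_0 b_0 q_0] : [/\ 0 <= k, 0 <= b & 0 <= q%:R :> R].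
  by split; [apply: le_trans kge1 | apply: le_trans bge1 |].
rewrite (_ : 4 * _ * _ / _ =
    4 * q%:R ^+ n.+1 * (1 + b * k) * (k ^+ (2 * s + 2 * n) * b ^+ (n + m)));
  last first.
  have -> : (2 * s + 2 * n = (s + n) * 2)%N by rewrite -mulnDr mulnC.
  rewrite -exprM -[_ * beta ^+ n * _]mulrA -exprD !invfM -!exprVn -/k -/b.
  by [].
rewrite (_ : (18 * _ / _) ^+ s =
    18 ^+ s * (q%:R ^+ (2 * s) * (k ^+ (5 * s) * b ^+ (3 * s)))); last first.
  rewrite invfM -!exprVn -/k -/b.
  by rewrite exprMn [(18 * _) ^+ s]exprMn [(k ^+ 5 * _) ^+ s]exprMn -!exprM !mulrA.
have big1 : 1 <= q%:R ^+ (2 * s) * (k ^+ (5 * s) * b ^+ (3 * s)).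
  by rewrite !mulr_ege1 // exprn_ege1.
set Q := q%:R ^+ (2 * s) * _ in big1 *.
have Q0 : 0 <= Q by apply: le_trans big1.
have termQ : q%:R ^+ n.+1 * (b * k) * (k ^+ (2 * s + 2 * n) * b ^+ (n + m)) <= Q.
  rewrite (_ : _ * (b * k) * _ =
    q%:R ^+ n.+1 * (k ^+ (2 * s + 2 * n).+1 * b ^+ (n + m).+1)); last first.
    by rewrite !exprS; ring.
  have bk0 : 0 <= k ^+ (2 * s + 2 * n).+1 * b ^+ (n + m).+1.
    by rewrite mulr_ge0 // exprn_ge0.
  apply: ler_pM; rewrite ?exprn_ge0 //; first exact: ler_weXn2l.
  by apply: ler_pM; rewrite ?exprn_ge0 //; exact: ler_weXn2l.
have one_bk : 1 + b * k <= 2 * (b * k).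
  by rewrite mulr2n mulrDl mul1r lerD2r mulr_ege1.
apply: (@le_trans _ _ (Q + m%:R * (8 * Q))).
  apply: lerD => //; apply: ler_wpM2l => //.
  apply: (@le_trans _ _ (4 * q%:R ^+ n.+1 * (2 * (b * k)) *
     (k ^+ (2 * s + 2 * n) * b ^+ (n + m)))).
    rewrite ler_wpM2r ?mulr_ge0 ?exprn_ge0 // ler_wpM2l // mulr_ge0 ?exprn_ge0 //.
  rewrite (_ : 4 * _ * _ * _ = 8 * (q%:R ^+ n.+1 * (b * k) *
     (k ^+ (2 * s + 2 * n) * b ^+ (n + m)))); last by ring.
  by rewrite ler_wpM2l.
(* What is left is 1 + 8 * m <= 18 ^+ s, from 1 + 8 * m <= 9 * 2 ^ s. *)
rewrite -{1}[Q]mul1r mulrA -mulrDl ler_wpM2r //.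
apply: (@le_trans _ _ ((1 + m * 8)%N%:R)); first by rewrite natrD natrM.
rewrite -natrX ler_nat; apply: (@leq_trans (9 ^ s * 2 ^ s)%N); last first.
  by rewrite -expnMn.
apply: (@leq_trans (9 * 2 ^ s)%N); last first.
  by rewrite leq_mul2r -{1}(expn1 9) leq_exp2l // s0 orbT.
have m2s : (m < 2 ^ s)%N by apply: (leq_ltn_trans (leq_trans mn ns)); exact: ltn_expl.
apply: (@leq_trans (9 * m.+1)%N); last by rewrite leq_mul2l m2s orbT.
by rewrite [leqRHS]mulnS; apply: leq_add => //; rewrite mulnC leq_mul2r orbT.
Qed.

End Constants.

(** * The theorem *)
Section Main.
Variables (R : realType) (dstar : R).

(** A boundary vertex of a region has a neighbour in the region, which takes the
    diameter to at least 1. *)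
Lemma point_region_boundary (V : finType) (e : rel V) (U : {set V}) :
    irreflexive e -> bethe_region e U -> eleq (diam e U) (Some 0%N) ->
  #|[pred i | @at_boundary V e U i]| = 0%N.
Proof.
move=> e_irr treeU diamU; apply: eq_card0 => i; rewrite inE; apply/negP => iB.
have [inb nU _] := neighborP treeU iB.
have [k] := diam_gdist diamU (valP i) nU; rewrite leqn0 => /eqP ->.
case/walkP => -[|a p] [_ /= iE] //= _.
by rewrite -iE e_irr in inb.
Qed.

Lemma region_nonempty (V : finType) (e : rel V) (U : {set V}) :
  bethe_region e U -> (0 < #|U|)%N.
Proof. by case=> [[+ _] _]; rewrite card_sig. Qed.

Lemma valid_rate_shift (delta : nat -> R) (r n : nat) :
    valid_rate dstar delta -> 0 < delta 0%N -> (n <= r)%N ->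
  dstar ^+ r * delta 0%N <= delta n.
Proof.
move=> [d01 dmon _ ds0 dstep] d0 nr.
have ds1 : dstar <= 1.
  rewrite -(ler_pM2r d0) mul1r; apply: le_trans (dstep 0%N) _.
  exact: dmon.
apply: (@le_trans _ _ (dstar ^+ n * delta 0%N)).
  by rewrite ler_wpM2r ?(ltW d0) // ler_wiXn2l // ltW.
elim: n {nr} => [|n IH]; first by rewrite mul1r.
rewrite exprS -mulrA; apply: le_trans (dstep n).
by rewrite ler_wpM2l // ltW.
Qed.

End Main.

Unset Implicit Arguments.

Theorem theorem3p14 (R : realType) (q Delta : nat) (dstar kappa : R)
    (hDelta : (2 <= Delta)%N) :
  exists c : R,
  forall (X V : finType) (e : rel V)
    (psie : V -> V -> X -> X -> R) (psiv : V -> X -> R) (psimax : R)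
    (N : nat) (delta : nat -> R),
    #|X| = q ->
    simple_graph e ->
    max_degree e = Delta ->
    tree_like e N ->
    bounded_spec e psie psiv psimax ->
    permissive e psie psiv psimax kappa ->
    valid_rate dstar delta ->
    extremal e delta (gibbs e psie psiv) ->
    forall r : nat, (r.+1 < N)%N ->
      bethe_approximated e psie psiv (expR (c ^+ r) * delta (N - r)%N) r
        (gibbs e psie psiv) (standard_messages e psie psiv)
      /\ bethe_state e psie psiv (expR (c ^+ r) * delta (N - r)%N) r
        (gibbs e psie psiv).
Proof.
(* [A1] is the base of the loss in [error_factor_le]; [A2] is the inverse of the
   lower bound on [dstar * delta 0]; and [#|U| ^ 2 <= growth ^ r]. *)
pose beta : R := kappa ^+ (2 * Delta + 1) / q%:R.
pose A1 : R := 18 * q%:R ^+ 2 / (kappa ^+ 5 * beta ^+ 3).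
pose A2 : R := (2^-1 * (beta ^+ Delta.+1) ^+ 2 * dstar)^-1.
pose growth : R := (((1 + Delta) ^ 4)%N)%:R.
exists ((A1 + A2) * growth).
move=> X V e psie psiv psimax N delta cardX [e_sym e_irr] degE treeN bounded.
move=> [kappa_gt0 psiv_ge [xp psie_ge]] rate ext r rN.
have [v _] : exists v : V, true.
  have [w _|none] := pickP (@predT V); first by exists w.
  by move: hDelta; rewrite -degE /max_degree big_pred0.
have psi0 := psimax_gt0 bounded.
have kappa_le1 : kappa <= 1.
  rewrite -(ler_pM2r psi0) mul1r; apply: le_trans (psiv_ge v (xp v)) _.
  by case/andP: (psiv_bounds bounded v (xp v)).
have X_gt0 : (0 < #|X|)%N by apply/card_gt0P; exists (xp v).
have betaE : beta = permit_prob X e kappa.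
  by rewrite /permit_prob /cost degE cardX.
have beta_gt0 : 0 < beta by rewrite betaE; exact: permit_prob_gt0.
have beta_le1 : beta <= 1 by rewrite betaE; exact: permit_prob_le1.
have [d01 dmon _ ds0 _] := rate.
have d0 n : 0 <= delta n by case/andP: (d01 n).
have A1_ge1 : 1 <= A1.
  have kb0 : 0 < kappa ^+ 5 * beta ^+ 3 by rewrite mulr_gt0 // exprn_gt0.
  rewrite ler_pdivlMr // mul1r; apply: (@le_trans _ _ 1).
    by rewrite mulr_ile1 ?exprn_ile1 ?exprn_ge0 // ltW.
  by rewrite mulr_ege1 ?exprn_ege1 ?ler1n // -cardX.
have A2_ge0 : 0 <= A2.
  rewrite invr_ge0 mulr_ge0 ?(ltW ds0) // mulr_ge0 ?invr_ge0 //.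
  by rewrite exprn_ge0 // exprn_ge0 // ltW.
suff approx : bethe_approximated e psie psiv
    (expR (((A1 + A2) * growth) ^+ r) * delta (N - r)%N) r (gibbs e psie psiv)
    (standard_messages e psie psiv).
  by split => //; exists (standard_messages e psie psiv).
split.
- by apply: (gibbs_distr bounded kappa_gt0 psiv_ge psie_ge).
- by move=> i j ij; exact: (standard_messages_distr bounded kappa_gt0 psiv_ge psie_ge).
move=> U treeU diamU.
have mu_distr := marginal_distr bounded kappa_gt0 psiv_ge psie_ge U.
have nu_distr := bethe_distr bounded kappa_gt0 psiv_ge psie_ge U.
have [rN2|Nr2] := leqP (2 * r) N; last first.
  have r_gt0 : (0 < r)%N by case: r rN Nr2 {diamU}.
  case: (leqP #|X| 1) => [X1|X2].
    rewrite (tv_subsingleton mu_distr nu_distr) ?mulr_ge0 ?expR_ge0 //.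
    have X_eq1 : #|X| = 1%N by apply/eqP; rewrite eqn_leq X1.
    by rewrite card_ffun X_eq1 exp1n.
  apply: le_trans (tv_le1 mu_distr nu_distr) _.
  have rate0 : 2^-1 * (beta ^+ Delta.+1) ^+ 2 <= delta 0%N.
    rewrite betaE -degE.
    apply: (extremal_rate0 e_sym e_irr bounded kappa_gt0 kappa_le1 psiv_ge psie_ge
      X_gt0 v ext) => // n; exact: dmon.
  have rate0_gt0 : 0 < 2^-1 * (beta ^+ Delta.+1) ^+ 2.
    by rewrite mulr_gt0 ?invr_gt0 // exprn_gt0 // exprn_gt0.
  have delta0 := lt_le_trans rate0_gt0 rate0.
  have half1 : 2^-1 * (beta ^+ Delta.+1) ^+ 2 <= 1.
    by apply: le_trans rate0 _; case/andP: (d01 0%N).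
  have shift : dstar ^+ r * delta 0%N <= delta (N - r)%N.
    apply: valid_rate_shift rate delta0 _.
    by rewrite leq_subLR addnn -mul2n ltnW.
  have ds1 : dstar <= 1.
    by rewrite -(ler_pM2r delta0) mul1r; case: rate => _ _ _ _ step;
       apply: le_trans (step 0%N) _; exact: dmon.
  have A2_gt0 : 0 < A2 by rewrite invr_gt0 mulr_gt0.
  have A2_ge1 : 1 <= A2.
    rewrite /A2 invf_ge1; last exact: mulr_gt0.
    by apply: mulr_ile1 => //; exact: ltW.
  have small : A2 ^+ r * delta (N - r)%N >= 1.
    apply: (@le_trans _ _ (A2 ^+ r * (dstar ^+ r * delta 0%N))); last first.
      by rewrite ler_wpM2l // exprn_ge0.
    rewrite mulrA -exprMn.
    rewrite (_ : A2 * dstar = (2^-1 * (beta ^+ Delta.+1) ^+ 2)^-1); last first.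
      by rewrite /A2; move: rate0_gt0; set w := _ * _ => w0; field; rewrite !gt_eqF.
    set w := 2^-1 * _ in rate0 rate0_gt0 half1 *.
    apply: (@le_trans _ _ (w^-1 * delta 0%N)).
      by rewrite mulrC ler_pdivlMr // mul1r.
    rewrite ler_wpM2r ?(ltW delta0) //; case: r r_gt0 {rN diamU Nr2 shift} => // r _.
    by rewrite exprS ler_peMr ?invr_ge0 ?(ltW rate0_gt0) // exprn_ege1 // invf_ge1.
  apply: le_trans small _; rewrite ler_wpM2r //.
  apply: (power_le_exp (b := ((1 + Delta) ^ 4)%N)) => //.
    apply: leq_trans (ltnW (ltn_expl r (_ : 1 < 2)%N)) _ => //.
    rewrite leq_exp2r //; apply: (@leq_trans (2 ^ 4)%N) => //.
    by rewrite leq_exp2r // add1n ltnS (leq_trans _ hDelta).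
  by rewrite -/growth mulrDl lerDr mulr_ge0 // (le_trans _ A1_ge1).
have far := far_dist e U N r.
have decor : tv (joint_marginal (gibbs e psie psiv) U (far_set e U N r))
    (fun y => marginal (gibbs e psie psiv) U y.1 *
       marginal (gibbs e psie psiv) (far_set e U N r) y.2) <= delta (N - r)%N.
  apply: le_trans (ext U (far_set e U N r)) _.
  by case: (set_dist _ _ _) far => [m|] //= /ltnW; exact: dmon.
apply: le_trans (region_estimate e_sym e_irr bounded kappa_gt0 kappa_le1 psiv_ge
  psie_ge X_gt0 treeN treeU diamU rN2 decor) _.
rewrite -betaE cardX mulrC ler_wpM2r //.
have [r0|r_gt0] := posnP r.
  rewrite r0 in diamU *.
  rewrite (point_region_boundary e_irr treeU diamU) mul0r addr0 expr0.
  by apply: le_trans (expR_ge1Dx 1); rewrite lerDl.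
apply: (@le_trans _ _ (A1 ^+ (#|U| * #|U|))).
  apply: error_factor_le; rewrite ?kappa_gt0 ?beta_gt0 -?cardX //.
    exact: region_nonempty treeU.
  by apply: leq_trans (max_card _) _; rewrite card_sig.
apply: (power_le_exp (b := ((1 + Delta) ^ 4)%N)) => //.
  have := card_region diamU; rewrite degE => cU.
  apply: leq_trans (leq_mul cU cU) _; by rewrite -expnD -expnM -mulnDl.
by rewrite -/growth mulrDl lerDl mulr_ge0 // ler0n.
Qed.
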